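(* Let $m$ be a positive even integer, and let $d\ge1$ be a square-free odd integer. Then there exists a positive integer $n_d$ such that for all integers $n\ge n_d$, $$\mathrm{ord}_2\big(L(\chi_n\psi_d,1-m)\big)=1+2^{1-n}\cdot\Big(-1+\sum_{p\mid d}2^{f_p}\Big),$$ where the sum runs over the primes $p$ dividing $d$.
   Context: $\mathbb{Q}_n$ is the $n$-th layer of the cyclotomic $\mathbb{Z}_2$-extension of $\mathbb{Q}$. For $n\ge1$, $\chi_n$ is a primitive character of $\mathrm{Gal}(\mathbb{Q}_n/\mathbb{Q})$ (i.e. one of order $2^n$), viewed as an even primitive Dirichlet character modulo $2^{n+2}$. $\psi_d$ is the Dirichlet character associated to $\mathbb{Q}(\sqrt d)/\mathbb{Q}$ (trivial if $d=1$). $L(\rho,s)$ is the Dirichlet $L$-function of $\rho$. For an odd prime $p$, $p^*=\left(\frac{-1}{p}\right)p$ and $f_p=\mathrm{ord}_2\left(\frac{p^*-1}{4}\right)$. $\mathrm{ord}_2$ is a fixed $2$-adic valuation on $\overline{\mathbb{Q}}$ with $\mathrm{ord}_2(2)=1$. *)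

(* Defs.v *)
From HB Require Import structures.
From mathcomp Require Import all_boot all_order all_algebra all_field.
From mathcomp Require Import all_classical all_reals all_analysis.
From mathcomp Require Import complex.
Set Implicit Arguments.
Unset Strict Implicit.
Unset Printing Implicit Defensive.
Import Order.TTheory GRing.Theory Num.Theory numFieldNormedType.Exports.
Local Open Scope classical_set_scope.
Local Open Scope ring_scope.
Local Open Scope complex_scope.

(* The field Qbar of algebraic numbers is algC; an embedding Qbar -> C is a
   ring morphism {rmorphism algC -> R[i]} for R : realType. *)

Definition squarefree (d : nat) : Prop :=
  forall k : nat, (k ^ 2 %| d)%N -> k = 1%N.

(* A Dirichlet character modulo N, extended by 0 to all of int. *)
Definition dirichlet_character (N : nat) (chi : int -> algC) : Prop :=
  [/\ (0 < N)%N,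
      forall a : int, chi (a + N%:Z) = chi a,
      chi 1 = 1,
      forall a b : int, chi (a * b) = chi a * chi b &
      forall a : int, (chi a != 0) = coprimez a N%:Z].

(* A character modulo N is primitive if it is not induced from a proper
   divisor of N. *)
Definition primitive_character (N : nat) (chi : int -> algC) : Prop :=
  dirichlet_character N chi /\
  forall (M : nat) (chi' : int -> algC),
    (M %| N)%N -> dirichlet_character M chi' ->
    (forall a : int, coprimez a N%:Z -> chi a = chi' a) -> M = N.

Definition even_character (chi : int -> algC) : Prop := chi (-1) = 1.

(* k is the order of chi in the group of Dirichlet characters modulo N. *)
Definition character_order (N : nat) (chi : int -> algC) (k : nat) : Prop :=
  [/\ (0 < k)%N,
      forall a : int, coprimez a N%:Z -> chi a ^+ k = 1 &
      forall j : nat, (0 < j)%N ->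
        (forall a : int, coprimez a N%:Z -> chi a ^+ j = 1) -> (k <= j)%N].

(* The layer Q_n of the cyclotomic Z_2-extension is the maximal real subfield
   of the field of 2^(n+2)-th roots of unity, so the characters of Gal(Q_n/Q)
   are the even Dirichlet characters modulo 2^(n+2).  Since Gal(Q_n/Q) is
   cyclic of order 2^n, the primitive ones are those of order 2^n. *)
Definition primitive_layer_character (n : nat) (chi : int -> algC) : Prop :=
  [/\ primitive_character (2 ^ n.+2) chi,
      even_character chi &
      character_order (2 ^ n.+2) chi (2 ^ n)].

(* Discriminant of Q(sqrt d), for d >= 1 square-free; it is 1 for d = 1. *)
Definition quadratic_disc (d : nat) : nat :=
  if (d %% 4 == 1)%N then d else (4 * d)%N.

(* The Dirichlet character of Q(sqrt d)/Q.  Its conductor is the discriminant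
   D, and sigma_a (sqrt d) = psi a * sqrt d whenever sigma_a raises the D-th
   roots of unity to the power a. *)
Definition quadratic_character (d : nat) (psi : int -> algC) : Prop :=
  primitive_character (quadratic_disc d) psi /\
  forall (sigma : {rmorphism algC -> algC}) (a : int),
    coprimez a (quadratic_disc d)%:Z ->
    (forall z : algC, z ^+ quadratic_disc d = 1 -> sigma z = z ^ a) ->
    sigma (sqrtC d%:R) = psi a * sqrtC d%:R.

Definition legendre (a : int) (p : nat) : int :=
  if (p%:Z %| a)%Z then 0
  else if [exists x : 'I_p, ((x%:Z ^+ 2)%R == a %[mod p%:Z])%Z] then 1
  else -1.

Definition pstar (p : nat) : int := legendre (-1) p * p%:Z.

(* The division by 4 is exact for p odd. *)
Definition fexp (p : nat) : nat := logn 2 `|((pstar p - 1) %/ 4)%Z|%N.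

Definition dyadic_valuation (R : realType) (v : algC -> \bar R) : Prop :=
  [/\ forall x, v x != -oo%E,
      forall x, v x = +oo%E <-> x = 0,
      forall x y, v (x * y) = (v x + v y)%E,
      forall x y, (Order.min (v x) (v y) <= v (x + y)%R)%E &
      v 2 = 1%:E].

Definition cexp (R : realType) (z : R[i]) : R[i] :=
  (expR (complex.Re z))%:C * (cos (complex.Im z) +i* sin (complex.Im z)).

Definition has_sum (K : numFieldType) (u : nat -> K) (l : K) : Prop :=
  series u @ \oo --> l.

Definition analytic_at (K : numFieldType) (f : K -> K) (z0 : K) : Prop :=
  exists a : nat -> K,
    \forall z \near z0, has_sum (fun k => a k * (z - z0) ^+ k) (f z).

(* The term rho(k+1) (k+1)^(-s) of the Dirichlet series. *)
Definition dirichlet_term (R : realType) (rho : int -> R[i]) (s : R[i])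
    (k : nat) : R[i] :=
  rho k.+1%:Z * cexp (- s * (ln k.+1%:R)%:C).

(* L is the analytic continuation to C \ {1} of the Dirichlet series of rho,
   its value at 1 being left unspecified. *)
Definition is_dirichlet_L (R : realType) (rho : int -> R[i])
    (L : R[i] -> R[i]) : Prop :=
  (forall s : R[i], 1 < complex.Re s -> has_sum (dirichlet_term rho s) (L s)) /\
  (forall s : R[i], s != 1 -> analytic_at L s).

Definition dirichlet_L (R : realType) (rho : int -> R[i]) : R[i] -> R[i] :=
  xget (fun=> 0) [set L | is_dirichlet_L rho L].

(* Main.v *)
Require Import Defs.
From HB Require Import structures.
From mathcomp Require Import all_boot all_order all_algebra all_field.
From mathcomp Require Import all_classical all_reals all_analysis.
From mathcomp Require Import complex.
From mathcomp Require Import ring lra zify.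
Set Implicit Arguments.
Unset Strict Implicit.
Unset Printing Implicit Defensive.
Import Order.TTheory GRing.Theory Num.Theory numFieldNormedType.Exports.
Local Open Scope ring_scope.

(** The value L(rho, 1 - m), for rho = chi psi, is the regularized sum of the
    divergent series of rho(k) k^(m-1): the value at T = 1 of the rational function
    with Taylor coefficients rho(k) k^(m-1) at T = 0 ([regsum]). Two facts are needed,
    one analytic and one 2-adic.

    The analytic fact is [dirichlet_L_regsum]. Since rho is periodic with mean zero
    over a period, the Dirichlet series can be summed by parts r times with bounded
    periodic antidifferences, leaving boundary terms and a series of r-th differences
    of k^(-s), which converges absolutely for Re s > 1 - r. This continues L
    ([continuation_analytic]), the continuation is unique ([dirichlet_L_uniq]), and at
    s = 1 - m the differences of high order of the polynomial k^(m-1) vanish, so that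
    L(rho, 1 - m) is the finite boundary term ([continuation_value]). The regularized
    sum obeys the same summation by parts, hence is the same number
    ([regsum_boundary]), and this number is algebraic.

    The 2-adic fact is [val_regsum_twist]. For c prime to the period N and
    rho(c k) = w rho(k), inserting the factor 1 - c [c | k] multiplies the regularized
    sum by 1 - w c^m and makes it a sum over the classes a modulo N of rho(a) times a
    2-integral quantity ([dilated_sum]). Modulo N this quantity is the product of
    a^(m-1) and of an odd function of a, hence even because m is even; as rho is even
    too, the classes of a and -a contribute equally and the smoothed value is
    divisible by 2 ([even_dilated_sum]).

    For d = 1 and c = 3 half of the smoothed value is a unit, because modulo the maximal
    ideal it becomes an odd number ([val_regsum_odd_support]), while 1 - chi(3) 3^m has
    valuation 2^(1-n); so L(chi, 1 - m) has valuation 1 - 2^(1-n). Multiplying by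
    the Euler factors 1 - chi(p) p^(m-1) for p | d adds the sum of the 2^(1-n) 2^(f_p),
    since chi(p) = chi(pstar p), as chi is even, and this is a root of unity of order
    2^(n - f_p) ([layer_prime], [val_sub1_unity]).

    Finally psi is congruent modulo 2 to the indicator function of the integers prime
    to d on odd integers, so replacing one by the other, with c = 1 + 4 d, changes the
    value by something of valuation at least 2 - 2^(1-n) ([val_twist_diff]). For large
    n this is more than the valuation of the main term, which tends to 1. *)

(** * Regularized sums of sequences *)

(** The coefficient of degree k in the product of q with the formal power series
    having coefficients u. *)
Definition conv (F : nzRingType) (q : {poly F}) (u : nat -> F) (k : nat) : F :=
  \sum_(i < k.+1) q`_i * u (k - i)%N.

(** Abel's value of a divergent series: when the generating series of u is a
    rational function p / q without pole at 1, its regularized sum is the value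
    of that function at 1. *)
Definition regsum (F : fieldType) (u : nat -> F) (l : F) : Prop :=
  exists q p : {poly F},
    [/\ q.[1] != 0, forall k, conv q u k = p`_k & l = p.[1] / q.[1]].

(** Coefficients of a product only see truncations; this is what transfers the
    associativity of polynomial multiplication to [conv]. *)
Lemma conv_trunc (F : nzRingType) (q : {poly F}) u K k :
  (k < K)%N -> conv q u k = (q * \poly_(i < K) u i)`_k.
Proof.
move=> kK; rewrite coefM; apply: eq_bigr => i _.
by rewrite coef_poly (leq_ltn_trans _ kK) // leq_subr.
Qed.

Lemma eq_conv (F : nzRingType) (q : {poly F}) u v : u =1 v -> conv q u =1 conv q v.
Proof. by move=> e k; apply: eq_bigr => i _; rewrite e. Qed.

Lemma conv_polyM (F : nzRingType) (p q : {poly F}) u k :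
  conv (p * q) u k = conv p (conv q u) k.
Proof.
rewrite (@conv_trunc _ _ _ k.+1) // -mulrA coefM /conv.
apply: eq_bigr => i _; rewrite -/(conv q u _) (@conv_trunc _ _ _ k.+1) //.
by rewrite ltnS leq_subr.
Qed.

Lemma conv_coef (F : nzRingType) (p q : {poly F}) k : conv p (fun i => q`_i) k = (p * q)`_k.
Proof. by rewrite coefM. Qed.

Lemma convD (F : nzRingType) (q : {poly F}) u v k :
  conv q (fun i => u i + v i) k = conv q u k + conv q v k.
Proof. by rewrite -big_split; apply: eq_bigr => i _; rewrite mulrDr. Qed.

Lemma convZ (F : comNzRingType) (q : {poly F}) u a k :
  conv q (fun i => a * u i) k = a * conv q u k.
Proof. by rewrite mulr_sumr; apply: eq_bigr => i _; rewrite mulrCA. Qed.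

Lemma regsum_ext (F : fieldType) (u v : nat -> F) l : u =1 v -> regsum u l -> regsum v l.
Proof.
move=> e [q [p [q1 qp ->]]]; exists q, p; split=> // k.
by rewrite -(eq_conv _ e).
Qed.

(** Two representations p / q and p' / q' of the same series satisfy
    q' p = q p' as polynomials, by associativity, so they agree at 1. *)
Lemma regsum_uniq (F : fieldType) (u : nat -> F) l l' : regsum u l -> regsum u l' -> l = l'.
Proof.
move=> [q [p [q1 qp ->]]] [q' [p' [q1' qp' ->]]].
have e : q' * p = q * p'.
  apply/polyP => k; rewrite -!conv_coef -(eq_conv _ qp) -(eq_conv _ qp').
  by rewrite -!conv_polyM mulrC.
apply/eqP; rewrite eqr_div // -!hornerM.
by apply/eqP; rewrite [X in X.[1]]mulrC e mulrC.
Qed.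

Lemma regsumD (F : fieldType) (u v : nat -> F) l l' :
  regsum u l -> regsum v l' -> regsum (fun k => u k + v k) (l + l').
Proof.
move=> [q [p [q1 qp ->]]] [q' [p' [q1' qp' ->]]].
exists (q * q'), (q' * p + q * p'); split.
- by rewrite hornerM mulf_neq0.
- move=> k; rewrite convD coefD {1}mulrC !conv_polyM.
  by rewrite (eq_conv _ qp) (eq_conv _ qp') !conv_coef.
- by rewrite !hornerE; field; rewrite q1 q1'.
Qed.

Lemma regsumZ (F : fieldType) (u : nat -> F) l a :
  regsum u l -> regsum (fun k => a * u k) (a * l).
Proof.
move=> [q [p [q1 qp ->]]]; exists q, (a *: p); split=> // [k|].
  by rewrite convZ coefZ qp.
by rewrite hornerZ mulrA.
Qed.

Lemma regsum0 (F : fieldType) : regsum (fun=> 0 : F) 0.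
Proof.
exists 1, 0; split; first by rewrite hornerE oner_eq0.
  by move=> k; rewrite coef0 /conv big1 // => i _; rewrite mulr0.
by rewrite !hornerE.
Qed.

Lemma regsum_sum (F : fieldType) (I : Type) (r : seq I) (P : pred I)
    (u : I -> nat -> F) (l : I -> F) :
  (forall i, P i -> regsum (u i) (l i)) ->
  regsum (fun k => \sum_(i <- r | P i) u i k) (\sum_(i <- r | P i) l i).
Proof.
move=> ul; elim: r => [|i r IH].
  by rewrite big_nil; apply: regsum_ext (regsum0 F) => k; rewrite big_nil.
rewrite big_cons; case: ifP => Pi; last first.
  by apply: regsum_ext IH => k; rewrite big_cons Pi.
by apply: regsum_ext (regsumD (ul i Pi) IH) => k; rewrite big_cons Pi.
Qed.

(** Dropping the constant term and dividing by T does not change the value at 1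
    except for the dropped term. *)
Lemma regsumS (F : fieldType) (u : nat -> F) l :
  regsum u l -> regsum (fun k => u k.+1) (l - u 0).
Proof.
move=> [q [p [q1 qp ->]]].
have p0 : p`_0 = q`_0 * u 0 by rewrite -qp /conv big_ord1.
have [r er] : exists r, p - (u 0)%:P * q = 'X * r.
  exists (drop_poly 1 (p - (u 0)%:P * q)).
  rewrite -{1}[LHS](poly_take_drop 1) expr1 [RHS]mulrC -[RHS]add0r; congr (_ + _).
  apply/polyP => -[|k]; rewrite coef_take_poly coef0 //=.
  by rewrite coefB coefCM p0 mulrC subrr.
exists q, r; split=> // [k|].
  have := congr1 (fun s : {poly F} => s`_k.+1) er.
  rewrite coefXM /= => <-; rewrite coefB coefCM -qp /conv [in RHS]big_ord_recr /= subnn.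
  rewrite [u 0 * _]mulrC addrK; apply: eq_bigr => i _.
  by rewrite subSn // -ltnS.
have -> : r.[1] = p.[1] - u 0 * q.[1].
  have := congr1 (fun s : {poly F} => s.[1]) er.
  by rewrite !hornerE => <-.
by field.
Qed.

(** Regularized sums do not see the end of a telescoping sum: only the
    boundary term at 0 remains, as if u tended to 0. *)
Lemma regsum_telescope (F : fieldType) (u : nat -> F) l :
  regsum u l -> regsum (fun k => u k.+1 - u k) (- u 0).
Proof.
move=> ul; have := regsumD (regsumS ul) (regsumZ (-1) ul).
rewrite mulN1r addrAC subrr add0r.
by apply: regsum_ext => k; rewrite mulN1r.
Qed.

(** The generating series of the spread-out sequence is T^a U(T^N), which
    takes the same value at 1 as U. *)
Lemma regsum_progression (F : fieldType) (u : nat -> F) l N a :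
  (0 < N)%N -> regsum u l ->
  regsum (fun k => if (a <= k)%N && (N %| k - a)%N then u ((k - a) %/ N)%N else 0) l.
Proof.
move=> N0 [q [p [q1 qp ->]]].
exists (q \Po 'X^N), ('X^a * (p \Po 'X^N)); split.
- by rewrite horner_comp !hornerE expr1n.
- move=> k; set w := fun _ => _.
  have e : conv (q \Po 'X^N) w k =
      ((q \Po 'X^N) * ('X^a * ((\poly_(i < k.+1) u i) \Po 'X^N)))`_k.
    rewrite coefM /conv; apply: eq_bigr => i _; congr (_ * _).
    rewrite coefXnM /w; case: ltnP => //= ai; rewrite coef_comp_poly_Xn //.
    case: (N %| _)%N => //; rewrite coef_poly.
    suff -> : ((k - i - a) %/ N < k.+1)%N by [].
    by rewrite ltnS (leq_trans (leq_div _ _)) // -subnDA leq_subr.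
  rewrite e mulrCA -comp_polyM !coefXnM; case: ltnP => // ak.
  rewrite !coef_comp_poly_Xn //; case: ifP => // _.
  rewrite -conv_trunc ?qp // ltnS (leq_trans (leq_div _ _)) //.
  exact: leq_subr.
- by rewrite hornerM !horner_comp !hornerE !expr1n mul1r.
Qed.

(** Multiplying u by k applies T d/dT to its series, and the quotient rule
    turns p / q into T (q p' - q' p) / q^2. No denominators appear besides powers
    of q, which is the source of all integrality statements below. *)
Lemma conv_mulk (F : fieldType) (q p : {poly F}) u :
  (forall k, conv q u k = p`_k) ->
  forall k, conv (q * q) (fun k => k%:R * u k) k = ('X * (q * p^`() - q^`() * p))`_k.
Proof.
move=> qp.
have e k : conv q (fun k => k%:R * u k) k = ('X * p^`())`_k - conv ('X * q^`()) u k.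
  have -> : ('X * p^`())`_k = k%:R * p`_k.
    by rewrite coefXM; case: k => [|k]; rewrite ?mul0r // coef_deriv mulr_natl.
  rewrite -qp /conv mulr_sumr -sumrB; apply: eq_bigr => i _.
  have -> : ('X * q^`())`_i = i%:R * q`_i.
    by rewrite coefXM; case: (i : nat) => [|j]; rewrite ?mul0r // coef_deriv mulr_natl.
  rewrite natrB; last by rewrite -ltnS.
  ring.
move=> k; rewrite conv_polyM (eq_conv _ e) convD conv_coef.
rewrite (@eq_conv _ _ _ (fun i => - 1 * conv ('X * q^`()) u i)); last first.
  by move=> i; rewrite mulN1r.
rewrite convZ -conv_polyM mulrC [q * ('X * _)]mulrC conv_polyM (eq_conv _ qp).
rewrite conv_coef mulN1r -coefB; congr (fun s : {poly F} => s`_k).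
by ring.
Qed.

Definition seq_periodic (T : Type) (N : nat) (u : nat -> T) := forall k, u (k + N)%N = u k.

Lemma periodicM (T : Type) N (u : nat -> T) : seq_periodic N u ->
  forall j k, u (k + j * N)%N = u k.
Proof.
by move=> up; elim=> [|j IH] k; rewrite ?addn0 // mulSn addnA IH up.
Qed.

Lemma periodic_modn (T : Type) N (u : nat -> T) k : seq_periodic N u -> u (k %% N)%N = u k.
Proof. by move=> up; rewrite {2}(divn_eq k N) addnC periodicM. Qed.

Lemma periodic_sum (F : nmodType) N (u : nat -> F) k : seq_periodic N u ->
  \sum_(i < N) u (k + i)%N = \sum_(i < N) u i.
Proof.
move=> up; elim: k => [|k IH]; first by [].
rewrite -IH; case: N up {IH} => [|N] up; first by rewrite !big_ord0.
rewrite big_ord_recr big_ord_recl /= addrC addn0; congr (_ + _).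
  by rewrite addSn -addnS up.
by apply: eq_bigr => i _; rewrite addSnnS.
Qed.

(** The denominator of the series of an N-periodic sequence of mean zero: the
    factor 1 - T of 1 - T^N cancels exactly because the mean vanishes. *)
Definition geom_poly (F : nzRingType) (N : nat) : {poly F} := \poly_(i < N) 1.

Lemma geom_poly1 (F : nzRingType) N : (geom_poly F N).[1] = N%:R.
Proof.
rewrite /geom_poly horner_poly (eq_bigr (fun=> 1)).
  by rewrite sumr_const card_ord.
by move=> i _; rewrite expr1n mulr1.
Qed.

Lemma conv_periodic (F : nzRingType) N (u : nat -> F) :
  (0 < N)%N -> seq_periodic N u -> \sum_(i < N) u i = 0 ->
  forall k, conv (geom_poly F N) u k = (\poly_(k < N) \sum_(i < k.+1) u i)`_k.
Proof.
move=> N0 up u0 k; rewrite coef_poly /conv.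
case: ltnP => kN.
  rewrite (reindex_inj rev_ord_inj) /=; apply: eq_bigr => i _.
  rewrite coef_poly subSS (leq_ltn_trans (leq_subr _ _) kN) mul1r.
  by congr u; rewrite subKn // -ltnS.
rewrite (bigID (fun i : 'I_k.+1 => (i < N)%N)) /= addrC big1 ?add0r; last first.
  by move=> i /negbTE iN; rewrite coef_poly iN mul0r.
rewrite -(big_ord_widen_cond k.+1 xpredT (fun i => (geom_poly F N)`_i * u (k - i)%N)); last first.
  exact: leqW.
rewrite (reindex_inj rev_ord_inj) /= -[RHS]u0 -(periodic_sum (k - N.-1) up).
apply: eq_bigr => i _; rewrite coef_poly ltn_subrL /= N0 mul1r; congr u.
have := ltn_ord i; lia.
Qed.

Lemma regsum_periodic (F : fieldType) N (u : nat -> F) :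
  N%:R != 0 :> F -> seq_periodic N u -> \sum_(i < N) u i = 0 ->
  regsum u ((\sum_(k < N) \sum_(i < k.+1) u i) / N%:R).
Proof.
move=> N0 up u0; exists (geom_poly F N), (\poly_(k < N) \sum_(i < k.+1) u i).
split; rewrite ?geom_poly1 //.
  by apply: conv_periodic => //; case: (N) N0; rewrite ?eqxx.
rewrite horner_poly; congr (_ / _); apply: eq_bigr => i _.
by rewrite expr1n mulr1.
Qed.

(** Since the only denominators are powers of [geom_poly F N], whose value at
    1 is N, the regularized sums of u(k) k^i are integral away from N. *)
Lemma regsum_periodic_pow (F : fieldType) (S : subringClosed F) N (u : nat -> F) :
  N%:R != 0 :> F -> seq_periodic N u -> \sum_(i < N) u i = 0 ->
  (forall k, u k \in S) ->
  forall i, exists t, exists2 z, z \in S & regsum (fun k => k%:R ^+ i * u k) (z / N%:R ^+ t).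
Proof.
move=> N0 up u0 uS i.
have N0' : (0 < N)%N by case: (N) N0; rewrite ?eqxx.
suff [q [p [t [qS pS q1 qp]]]] : exists q p : {poly F}, exists t : nat,
    [/\ q \is a polyOver S, p \is a polyOver S, q.[1] = N%:R ^+ t
     & forall k, conv q (fun k => k%:R ^+ i * u k) k = p`_k].
  exists t, p.[1]; first by rewrite rpred_horner ?rpred1.
  by exists q, p; split; rewrite ?q1 ?expf_neq0.
elim: i => [|i [q [p [t [qS pS q1 qp]]]]].
  exists (geom_poly F N), (\poly_(k < N) \sum_(i < k.+1) u i), 1%N; split.
  - by apply/polyOver_poly => j _; rewrite rpred1.
  - by apply/polyOver_poly => j _; rewrite rpred_sum.
  - by rewrite geom_poly1 expr1.
  - move=> k; rewrite -conv_periodic //; apply: eq_conv => j.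
    by rewrite expr0 mul1r.
exists (q * q), ('X * (q * p^`() - q^`() * p)), (t + t)%N; split.
- by rewrite rpredM.
- by rewrite rpredM ?polyOverX // rpredB // rpredM // polyOver_deriv.
- by rewrite hornerM q1 exprD.
- move=> k; rewrite -(conv_mulk qp); apply: eq_conv => j.
  by rewrite exprS mulrA.
Qed.

(** * Smoothing by an auxiliary prime-to-N modulus *)

(** The elements of Z[1/c]; for odd c they are 2-integral. *)
Definition int_away (c : nat) (x : algC) : Prop :=
  exists t : nat, x * c%:R ^+ t \in Num.int.

Lemma int_away_int c x : x \in Num.int -> int_away c x.
Proof. by exists 0%N; rewrite mulr1. Qed.

Lemma int_awayM c x y : int_away c x -> int_away c y -> int_away c (x * y).
Proof.
move=> [t xt] [t' yt]; exists (t + t')%N.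
by rewrite exprD mulrACA rpredM.
Qed.

Lemma int_awayD c x y : int_away c x -> int_away c y -> int_away c (x + y).
Proof.
move=> [t xt] [t' yt]; exists (t + t')%N; rewrite exprD mulrDl rpredD //.
  by rewrite mulrA rpredM // rpredX // rpred_nat.
by rewrite [c%:R ^+ t * _]mulrC mulrA rpredM // rpredX // rpred_nat.
Qed.

Lemma int_away_sum c (I : Type) (r : seq I) (P : pred I) (f : I -> algC) :
  (forall i, P i -> int_away c (f i)) -> int_away c (\sum_(i <- r | P i) f i).
Proof.
move=> fI; elim/big_ind: _ => //; last exact: int_awayD.
by apply: int_away_int; rewrite rpred0.
Qed.

(** Multiplication by this function removes the mean of a sequence over every
    residue class modulo N, for c prime to N, while it multiplies the regularized sum
    of rho(k) k^m by 1 - w c^(m+1) when rho(c k) = w rho(k). The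
    regularized sum of a periodic sequence has denominators dividing powers of its
    period, which is highly divisible by 2 for the characters considered here; the
    smoothed sums are integral away from c. *)
Definition smoothing (c k : nat) : algC := 1 - (if (c %| k)%N then c%:R else 0).

(** The regularized sum of the smoothing function along the progression
    a, a + N, a + 2 N, and so on. *)
Definition smoothing_const (c N a : nat) : algC :=
  (\sum_(k < c) \sum_(i < k.+1) smoothing c (a + N * i)) / c%:R.

Section Smoothing.
Variables (c N : nat).
Hypotheses (c0 : (0 < c)%N) (cN : coprime c N).

Lemma smoothing_int k : smoothing c k \in Num.int.
Proof. by rewrite /smoothing rpredB ?rpred1 //; case: ifP; rewrite ?rpred0 ?rpred_nat. Qed.

Lemma smoothing_mod k : smoothing c (k %% c) = smoothing c k.
Proof. by rewrite /smoothing /dvdn modn_mod. Qed.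

Lemma smoothing_periodic a : seq_periodic c (fun i => smoothing c (a + N * i)).
Proof.
by move=> k; rewrite -smoothing_mod -[RHS]smoothing_mod mulnDr addnA -modnDmr modnMl addn0.
Qed.

(** As i runs over the residues modulo c, so does a + N i, hence exactly
    one of these numbers is divisible by c. *)
Lemma smoothing_sum0 a : \sum_(i < c) smoothing c (a + N * i) = 0.
Proof.
have f_lt (i : 'I_c) : ((a + N * i) %% c < c)%N by rewrite ltn_pmod.
pose f i := Ordinal (f_lt i).
have f_inj : injective f.
  move=> i j /(congr1 val) /= /eqP; rewrite eqn_modDl.
  wlog ij : i j / (i <= j)%N.
    move=> H; case: (leqP i j) => [|/ltnW] ij; first exact: H.
    by rewrite eq_sym => /(H _ _ ij).
  rewrite eq_sym eqn_mod_dvd ?leq_mul // -mulnBr Gauss_dvdr // => dv.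
  apply/val_inj/eqP => /=; rewrite eqn_leq ij /=.
  rewrite -subn_eq0; apply: contraLR dv => n0.
  by rewrite gtnNdvd ?lt0n // (leq_ltn_trans (leq_subr _ _)).
rewrite (eq_bigr (fun i => smoothing c (f i))); last by move=> i _; rewrite smoothing_mod.
rewrite -(reindex_inj f_inj (P := xpredT) (F := fun i : 'I_c => smoothing c i)) /=.
rewrite /smoothing sumrB sumr_const card_ord -[1 *+ c]/(c%:R).
rewrite (bigD1 (Ordinal c0)) //= dvdn0 big1 ?addr0 ?subrr // => i.
case: ifP => // /dvdnP[[|k] ik]; last by have := ltn_ord i; rewrite ik mulSn ltnNge leq_addr.
by case/eqP; apply: val_inj.
Qed.

Lemma smoothing_const_regsum a :
  regsum (fun i => smoothing c (a + N * i)) (smoothing_const c N a).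
Proof.
apply: regsum_periodic; [by rewrite pnatr_eq0 -lt0n|exact: smoothing_periodic|exact: smoothing_sum0].
Qed.

Lemma smoothing_const_int_away a : int_away c (smoothing_const c N a).
Proof.
exists 1%N; rewrite expr1 divfK ?pnatr_eq0 -?lt0n //.
by rewrite !rpred_sum // => i _; rewrite rpred_sum // => j _; rewrite smoothing_int.
Qed.

Lemma smoothing_opp a b : (c %| a + b)%N -> smoothing c a = smoothing c b.
Proof.
move=> dv; rewrite /smoothing; suff -> : (c %| a)%N = (c %| b)%N by [].
by apply/idP/idP => H; [rewrite -(dvdn_addr b H)|rewrite -(dvdn_addl a H)].
Qed.

(** The partial sums from the right are the opposites of the partial sums from
    the left, the total being zero. *)
Lemma sum_rev_partial (F : zmodType) n (g : nat -> F) : \sum_(i < n) g i = 0 ->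
  \sum_(k < n) \sum_(i < k.+1) g (n.-1 - i)%N = - \sum_(k < n) \sum_(i < k.+1) g i.
Proof.
move=> g0.
have e (k : 'I_n) : \sum_(i < k.+1) g (n.-1 - i)%N = - \sum_(i < n.-1 - k) g i.
  rewrite (reindex_inj rev_ord_inj) /=; apply/eqP; rewrite -addr_eq0 addrC; apply/eqP.
  rewrite -[RHS]g0; have kn := ltn_ord k.
  have -> : \sum_(i < n) g i = \sum_(i < n.-1 - k + k.+1) g i.
    by rewrite -!(big_mkord xpredT g); congr (\sum_(0 <= i < _) _); lia.
  rewrite big_split_ord /=; congr (_ + _); apply: eq_bigr => i _; congr g.
  by have := ltn_ord i; lia.
rewrite (eq_bigr _ (fun k _ => e k)) sumrN; congr (- _).
rewrite (reindex_inj rev_ord_inj) /=.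
rewrite [RHS](eq_bigr (fun k : 'I_n => \sum_(i < k) g i + g k)); last first.
  by move=> k _; rewrite big_ord_recr.
rewrite big_split /= g0 addr0; apply: eq_bigr => k _.
suff -> : (n.-1 - (n - k.+1) = k)%N by [].
by have := ltn_ord k; lia.
Qed.

(** The smoothing function is even, and i |-> c - 1 - i exchanges the
    progressions of a and N - a modulo c. Together with the antisymmetry of
    a^m for odd m, this produces an extra factor 2 for even characters. *)
Lemma smoothing_const_opp a :
  (a <= N)%N -> smoothing_const c N (N - a) = - smoothing_const c N a.
Proof.
move=> aN; have /= E := sum_rev_partial (g := fun i => smoothing c (a + N * i)) (smoothing_sum0 a).
rewrite /smoothing_const -mulNr -E; congr (_ / _).
apply: eq_bigr => k _; apply: eq_bigr => i _; apply: smoothing_opp.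
have ik : (i < c)%N := leq_trans (ltn_ord i) (ltn_ord k).
suff -> : (N - a + N * i + (a + N * (c.-1 - i)) = c * N)%N by rewrite dvdn_mulr.
have e : (c = i + (c.-1 - i) + 1)%N by lia.
rewrite [in RHS]e !mulnDl mul1n [(N * i)%N]mulnC [(N * _)%N]mulnC; lia.
Qed.
End Smoothing.

(** Expanding (a + N j)^m, every term but the first is divisible by N. *)
Lemma dilated_term c N m a : (0 < c)%N -> coprime c N -> exists e : algC,
  int_away c e /\
  regsum (fun j => (a + N * j)%:R ^+ m * smoothing c (a + N * j))
    (a%:R ^+ m * smoothing_const c N a + N%:R * e).
Proof.
move=> c0 cN.
have cn0 : c%:R != 0 :> algC by rewrite pnatr_eq0 -lt0n.
have [z zP] : {z : nat -> algC & forall i, int_away c (z i) /\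
    regsum (fun k => k%:R ^+ i * smoothing c (a + N * k)) (z i)}.
  apply: (@boolp.choice _ _ (fun i y => int_away c y /\
    regsum (fun k => k%:R ^+ i * smoothing c (a + N * k)) y)) => i.
  have [t [y yS yP]] := @regsum_periodic_pow _ _ c _ cn0
    (@smoothing_periodic c N a) (smoothing_sum0 c0 cN a) (fun k => smoothing_int c _) i.
  exists (y / c%:R ^+ t); split=> //; exists t.
  by rewrite divfK // expf_neq0.
pose e := \sum_(i < m) 'C(m, i.+1)%:R * (a%:R ^+ (m - i.+1) * N%:R ^+ i) * z i.+1.
exists e; split.
  apply: int_away_sum => i _; apply: int_awayM; last by have [] := zP i.+1.
  by apply: int_away_int; rewrite rpredM ?rpred_nat // rpredM ?rpredX ?rpred_nat.
pose y i := if i is j.+1 then z j.+1 else smoothing_const c N a.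
have yP i : regsum (fun k => k%:R ^+ i * smoothing c (a + N * k)) (y i).
  case: i => [|i]; last by have [] := zP i.+1.
  by apply: regsum_ext (smoothing_const_regsum c0 cN a) => k; rewrite expr0 mul1r.
have -> : a%:R ^+ m * smoothing_const c N a + N%:R * e =
    \sum_(i < m.+1) 'C(m, i)%:R * (a%:R ^+ (m - i) * N%:R ^+ i) * y i.
  rewrite big_ord_recl /= bin0 subn0 expr0 mulr1 mul1r; congr (_ + _).
  rewrite mulr_sumr; apply: eq_bigr => i _; rewrite /= exprS; ring.
apply: regsum_ext (regsum_sum _ (fun (i : 'I_m.+1) _ =>
  regsumZ ('C(m, i)%:R * (a%:R ^+ (m - i) * N%:R ^+ i)) (yP i))) => k /=.
rewrite natrD natrM exprDn mulr_suml; apply: eq_bigr => i _.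
by rewrite -mulr_natl exprMn; ring.
Qed.

(** The two evaluations of the regularized sum of rho(k) k^m (1 - c [c | k]):
    the terms with c | k reproduce the sum itself multiplied by w c^(m+1), and sorting
    k by its class modulo N gives the right-hand side. *)
Lemma dilated_sum (rho : nat -> algC) N c m w l : (0 < N)%N -> (0 < c)%N ->
  coprime c N -> seq_periodic N rho -> (forall k, rho (c * k)%N = w * rho k) ->
  regsum (fun k => k%:R ^+ m * rho k) l ->
  exists2 e : nat -> algC, (forall a, int_away c (e a)) &
  (1 - w * c%:R ^+ m.+1) * l =
    \sum_(a < N) rho a * (a%:R ^+ m * smoothing_const c N a + N%:R * e a).
Proof.
move=> N0 c0 cN rp rc rl.
have [e eP] := boolp.choice (fun a => dilated_term m a c0 cN).
exists e; first by move=> a; have [] := eP a.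
have e1 := regsum_sum (index_enum 'I_N) (fun (a : 'I_N) (_ : true) =>
  regsumZ (rho a) (regsum_progression a N0 (eP a).2)).
apply: (regsum_uniq _ e1).
have -> : (1 - w * c%:R ^+ m.+1) * l = l + (- c%:R * (c%:R ^+ m * w)) * l.
  by rewrite exprS; ring.
have := regsum_progression 0 c0 (regsumZ (- c%:R * (c%:R ^+ m * w)) rl).
move=> /(regsumD rl); apply: regsum_ext => k.
rewrite (bigD1 (Ordinal (ltn_pmod k N0))) //= big1 ?addr0; last first.
  move=> a ak; case: ifP => [/andP[ak' dv]|]; rewrite ?mulr0 //.
  case/eqP: ak; apply: val_inj => /=; apply/eqP; move: dv.
  by rewrite -eqn_mod_dvd // => /eqP ->; rewrite modn_small.
rewrite leq_mod periodic_modn //.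
have dk : (k = k %% N + N * ((k - k %% N) %/ N))%N.
  rewrite {1}(divn_eq k N) addnC mulnC; congr (_ + N * _)%N.
  by rewrite {2}(divn_eq k N) addnK mulnK.
have -> : (N %| k - k %% N)%N by rewrite {1}(divn_eq k N) addnK dvdn_mull.
rewrite /= -dk /smoothing subn0.
case: ifP => [/dvdnP[j ->]|_]; last by rewrite subr0 addr0; ring.
rewrite mulnK // [(j * c)%N]mulnC rc natrM exprMn; ring.
Qed.

(** * Summation by parts *)

(** The improper subring, for applying [regsum_periodic_pow] when only the
    existence of the regularized sum matters. *)
Definition every_element (F : Type) : {pred F} := xpredT.

Lemma every_element_subring (F : nzRingType) : subring_closed (@every_element F).
Proof. by []. Qed.
HB.instance Definition _ (F : nzRingType) :=
  GRing.isSubringClosed.Build F (@every_element F) (@every_element_subring F).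

(** Multiplication by c permutes the residues modulo N, so the sum S over a
    period satisfies S = w S. *)
Lemma mean_zero_periodic (F : idomainType) N c (rho : nat -> F) w : (0 < N)%N ->
  coprime c N -> seq_periodic N rho -> (forall k, rho (c * k)%N = w * rho k) -> w != 1 ->
  \sum_(k < N) rho k = 0.
Proof.
move=> N0 cN rp rc w1.
have f_lt (i : 'I_N) : ((c * i) %% N < N)%N by rewrite ltn_pmod.
pose f i := Ordinal (f_lt i).
have f_inj : injective f.
  move=> i j /(congr1 val) /= /eqP.
  wlog ij : i j / (i <= j)%N.
    move=> H; case: (leqP i j) => [|/ltnW] ij; first exact: H.
    by rewrite eq_sym => /(H _ _ ij).
  rewrite eq_sym eqn_mod_dvd ?leq_mul // -mulnBr Gauss_dvdr 1?coprime_sym // => dv.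
  apply/val_inj/eqP => /=; rewrite eqn_leq ij /=.
  rewrite -subn_eq0; apply: contraLR dv => n0.
  by rewrite gtnNdvd ?lt0n // (leq_ltn_trans (leq_subr _ _)).
have : \sum_(k < N) rho k = w * \sum_(k < N) rho k.
  rewrite mulr_sumr {1}(reindex_inj f_inj) /=.
  by apply: eq_bigr => i _; rewrite periodic_modn // rc.
move/eqP; rewrite eq_sym -subr_eq0 -{2}[\sum_(_ < _) _]mul1r -mulrBl mulf_eq0.
by rewrite subr_eq0 (negbTE w1) => /eqP.
Qed.

Section SummationByParts.
Variable F : numFieldType.
Implicit Types (a f : nat -> F) (N : nat).

Definition mean_zero N a := seq_periodic N a /\ \sum_(k < N) a k = 0.

(** The periodic antidifference of a, with its constant chosen so that it has
    again mean zero and the construction can be iterated. *)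
Definition antidiff N a k : F :=
  \sum_(j < k) a j - (\sum_(i < N) \sum_(j < i) a j) / N%:R.

Definition antidiffS N a k : F := antidiff N a k.+1.

Definition nabla f k : F := f k - f k.+1.

(** What r summations by parts of the series of a(k) f(k) leave at the lower
    end, namely minus the sum over j < r of b_j(0) (nabla^j f)(0), where b_j is the
    antidifference of the j-th iterate of a. *)
Definition boundary_sum N r a f : F :=
  - \sum_(j < r) antidiff N (iter j (antidiffS N) a) 0 * iter j nabla f 0.

Lemma antidiff_diff N a k : antidiff N a k.+1 - antidiff N a k = a k.
Proof. by rewrite /antidiff big_ord_recr /=; ring. Qed.

Lemma antidiff_mean_zero N a : (0 < N)%N -> mean_zero N a -> mean_zero N (antidiff N a).
Proof.
move=> N0 [ap a0]; split.
  move=> k; rewrite /antidiff; congr (_ - _).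
  rewrite big_split_ord /= (eq_bigr (fun i : 'I_N => a (k + i)%N)) //.
  by rewrite periodic_sum // a0 addr0.
rewrite /antidiff sumrB sumr_const card_ord -[X in _ - X]mulr_natr.
by rewrite divfK ?subrr // pnatr_eq0 -lt0n.
Qed.

Lemma mean_zeroS N a : mean_zero N a -> mean_zero N (fun k => a k.+1).
Proof.
move=> [ap a0]; split; first by move=> k; rewrite -addSn.
rewrite -{2}a0 -(periodic_sum 1 ap); apply: eq_bigr => i _.
by rewrite add1n.
Qed.

Lemma antidiffS_mean_zero N a r : (0 < N)%N -> mean_zero N a ->
  mean_zero N (iter r (antidiffS N) a).
Proof.
move=> N0 az; elim: r => //= r IH.
exact/mean_zeroS/antidiff_mean_zero.
Qed.

Lemma boundary_sumS N r a f : boundary_sum N r.+1 a f =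
  - (antidiff N a 0 * f 0) + boundary_sum N r (antidiffS N a) (nabla f).
Proof.
rewrite /boundary_sum big_ord_recl /= opprD; congr (_ - _).
by apply: eq_bigr => i _; rewrite -!iterSr.
Qed.

Lemma mean_zero_regsum_poly N a (p : {poly F}) : (0 < N)%N -> mean_zero N a ->
  exists l, regsum (fun k => a k * p.[k%:R]) l.
Proof.
move=> N0 [ap a0].
have n0 : N%:R != 0 :> F by rewrite pnatr_eq0 -lt0n.
have [z zP] : {z : nat -> F & forall i, regsum (fun k => k%:R ^+ i * a k) (z i)}.
  apply: (@boolp.choice _ _ (fun i y => regsum (fun k => k%:R ^+ i * a k) y)) => i.
  have [t [y _ yP]] := @regsum_periodic_pow F (@every_element F) N a n0 ap a0 (fun=> isT) i.
  by exists (y / N%:R ^+ t).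
exists (\sum_(i < size p) p`_i * z i).
apply: regsum_ext (regsum_sum _ (fun (i : 'I_(size p)) _ => regsumZ p`_i (zP i))) => k /=.
by rewrite horner_coef mulr_sumr; apply: eq_bigr => i _; ring.
Qed.

Lemma size_nabla_poly (p : {poly F}) r : (size p <= r.+1)%N ->
  (size (p - (p \Po ('X + 1)))%R <= r)%N.
Proof.
move=> pr; have -> : p - (p \Po ('X + 1)) = \sum_(i < size p) p`_i *: ('X^i - ('X + 1) ^+ i).
  rewrite comp_polyE -{1}[p]coefK poly_def -sumrB.
  by apply: eq_bigr => i _; rewrite scalerBr.
apply: (leq_trans (size_sum _ _ _)); apply/bigmax_leqP => i _.
apply: (leq_trans (size_scale_leq _ _)).
rewrite exprDn big_ord_recl /= subn0 expr0 mulr1 bin0 mulr1n opprD addrA subrr add0r size_polyN.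
apply: (leq_trans (size_sum _ _ _)); apply/bigmax_leqP => j _.
rewrite expr1n mulr1 -scaler_nat; apply: (leq_trans (size_scale_leq _ _)).
rewrite size_polyXn /bump /= add1n subnSK //.
by apply: (leq_trans (leq_subr _ _)); rewrite -ltnS (leq_trans (ltn_ord i)).
Qed.

Lemma nabla_poly (p : {poly F}) k :
  nabla (fun j => p.[j%:R]) k = (p - (p \Po ('X + 1))).[k%:R].
Proof. by rewrite /nabla !hornerE horner_comp !hornerE natr1. Qed.

Lemma eq_iter_nabla f g r : f =1 g -> iter r nabla f =1 iter r nabla g.
Proof. by move=> e; elim: r => //= r IH k; rewrite /nabla !IH. Qed.

Lemma iter_nabla_poly (p : {poly F}) r k : (size p <= r)%N ->
  iter r nabla (fun j => p.[j%:R]) k = 0.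
Proof.
elim: r p k => [|r IH] p k pr.
  by move: pr; rewrite leqn0 size_poly_eq0 => /eqP -> /=; rewrite horner0.
rewrite iterSr (eq_iter_nabla _ (nabla_poly p)) IH //.
exact: size_nabla_poly.
Qed.

(** Both sides satisfy the same recursion under summation by parts, and for a
    polynomial f of degree less than r the remaining series of a_r(k) (nabla^r f)(k)
    is zero. Hence the regularized sum equals the finite boundary term; the analytic
    continuation of the Dirichlet series takes the same value, by the same
    computation. *)
Lemma regsum_boundary N r a (p : {poly F}) : (0 < N)%N -> mean_zero N a ->
  (size p <= r)%N ->
  regsum (fun k => a k * p.[k%:R]) (boundary_sum N r a (fun k => p.[k%:R])).
Proof.
move=> N0; elim: r a p => [|r IH] a p az pr.
  rewrite /boundary_sum big_ord0 oppr0.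
  move: pr; rewrite leqn0 size_poly_eq0 => /eqP ->.
  by apply: regsum_ext (regsum0 F) => k; rewrite horner0 mulr0.
rewrite boundary_sumS.
have [l bl] := mean_zero_regsum_poly p N0 (antidiff_mean_zero N0 az).
have h1 := regsum_telescope bl; have az' := antidiffS_mean_zero 1 N0 az.
have := IH _ _ az' (size_nabla_poly pr).
have -> : boundary_sum N r (antidiffS N a) (fun k => (p - (p \Po ('X + 1))).[k%:R]) =
   boundary_sum N r (antidiffS N a) (nabla (fun k => p.[k%:R])).
  congr (- _); apply: eq_bigr => i _; congr (_ * _).
  by apply: eq_iter_nabla => k; rewrite nabla_poly.
move/(regsumD h1); apply: regsum_ext => k.
rewrite -nabla_poly /antidiffS /nabla -(antidiff_diff N a k) /=.
by move: (antidiff _ _ _) (antidiff _ _ _) p.[_] p.[_] => x y z t; ring.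
Qed.
End SummationByParts.

Lemma boundary_sum_rmorph (F K : numFieldType) (g : {rmorphism F -> K}) N r
    (a f : nat -> F) :
  g (boundary_sum N r a f) = boundary_sum N r (g \o a) (g \o f).
Proof.
have gA b k : g (antidiff N b k) = antidiff N (g \o b) k.
  rewrite /antidiff rmorphB fmorph_div rmorph_nat !rmorph_sum; congr (_ - _ / _).
  by apply: eq_bigr => i _; rewrite rmorph_sum.
have gAi j k : g (iter j (antidiffS N) a k) = iter j (antidiffS N) (g \o a) k.
  elim: j k => //= j IH k; rewrite /antidiffS gA /antidiff /=; congr (_ - _ / _).
    by apply: eq_bigr => i _.
  by apply: eq_bigr => i _; apply: eq_bigr.
have gn j k : g (iter j (@nabla F) f k) = iter j (@nabla K) (g \o f) k.
  by elim: j k => //= j IH k; rewrite /nabla rmorphB !IH.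
rewrite /boundary_sum rmorphN rmorph_sum; congr (- _); apply: eq_bigr => j _.
rewrite rmorphM gn gA /antidiff; congr ((_ - _ / _) * _).
  by apply: eq_bigr => i _; exact: gAi.
by apply: eq_bigr => i _; apply: eq_bigr => i' _; exact: gAi.
Qed.

(** * Dyadic valuations of algebraic numbers *)

Section Valuation.
Variables (R : realType) (v : algC -> \bar R).
Hypothesis hv : dyadic_valuation v.

Definition vge (r : R) (x : algC) := (r%:E <= v x)%E.
Definition vgt (r : R) (x : algC) := (r%:E < v x)%E.

Let val_neq_ninfty x : v x != -oo%E. Proof. by case: hv. Qed.
Lemma val_eq_pinfty x : v x = +oo%E <-> x = 0. Proof. by case: hv. Qed.
Lemma val_mul x y : v (x * y) = (v x + v y)%E. Proof. by case: hv. Qed.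
Lemma val_add_min x y : (Order.min (v x) (v y) <= v (x + y)%R)%E. Proof. by case: hv. Qed.
Lemma val_two : v 2 = 1%:E. Proof. by case: hv. Qed.
Lemma val_zero : v 0 = +oo%E. Proof. exact/val_eq_pinfty. Qed.

Lemma val_fin x : x != 0 -> exists r : R, v x = r%:E.
Proof.
move=> x0; have := val_neq_ninfty x; case e: (v x) => [r| |] //; first by exists r.
by move/val_eq_pinfty: e x0 => ->; rewrite eqxx.
Qed.

Lemma val_one : v 1 = 0%:E.
Proof.
have [r e] := val_fin (oner_neq0 _).
have := val_mul 1 1; rewrite mulr1 e -EFinD => -[] h.
by congr (_%:E); lra.
Qed.

Lemma valX_eq0 x k : (0 < k)%N -> v (x ^+ k) = 0%:E -> v x = 0%:E.
Proof.
move=> k0; have [->|x0] := eqVneq x 0; first by rewrite expr0n eqn0Ngt k0 val_zero.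
have [r e] := val_fin x0; rewrite e => h.
have : v (x ^+ k) = (r *+ k)%:E.
  elim: k {k0 h} => [|k IH]; first by rewrite val_one.
  by rewrite exprS val_mul IH e -EFinD mulrS.
rewrite h => -[] /esym/eqP; rewrite mulrn_eq0 => /orP[/eqP k00|/eqP -> //].
by rewrite k00 in k0.
Qed.

Lemma val_unity x k : (0 < k)%N -> x ^+ k = 1 -> v x = 0%:E.
Proof. by move=> k0 h; apply: (valX_eq0 k0); rewrite h val_one. Qed.

Lemma val_opp x : v (- x) = v x.
Proof.
have h : v (-1) = 0%:E by apply: (@val_unity _ 2) => //; rewrite sqrrN expr1n.
by rewrite -mulN1r val_mul h add0e.
Qed.

Lemma vge0 r : vge r 0. Proof. by rewrite /vge val_zero leey. Qed.
Lemma vgt_vge r x : vgt r x -> vge r x. Proof. exact: ltW. Qed.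
Lemma vge_vgt r s x : s < r -> vge r x -> vgt s x.
Proof. by move=> sr; apply: lt_le_trans; rewrite lte_fin. Qed.
Lemma vgeN r x : vge r (- x) = vge r x. Proof. by rewrite /vge val_opp. Qed.
Lemma vgtN r x : vgt r (- x) = vgt r x. Proof. by rewrite /vgt val_opp. Qed.

Lemma vgeD r x y : vge r x -> vge r y -> vge r (x + y).
Proof. by move=> hx hy; apply: le_trans (val_add_min x y); rewrite le_min; apply/andP. Qed.
Lemma vgtD r x y : vgt r x -> vgt r y -> vgt r (x + y).
Proof. by move=> hx hy; apply: lt_le_trans (val_add_min x y); rewrite lt_min; apply/andP. Qed.
Lemma vgeM r s x y : vge r x -> vge s y -> vge (r + s) (x * y).
Proof. by move=> hx hy; rewrite /vge val_mul EFinD leeD. Qed.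
Lemma vgtM0 x y : vgt 0 x -> vge 0 y -> vgt 0 (x * y).
Proof.
rewrite /vgt /vge val_mul; move: (val_neq_ninfty x) (val_neq_ninfty y).
case: (v x) => [a| |]; case: (v y) => [b| |] // _ _.
by rewrite -EFinD !lte_fin lee_fin => ? ?; lra.
Qed.

Lemma vge_sum r (I : Type) (s : seq I) (P : pred I) (f : I -> algC) :
  (forall i, P i -> vge r (f i)) -> vge r (\sum_(i <- s | P i) f i).
Proof. by move=> h; elim/big_ind: _ => //; [exact: vge0|exact: vgeD]. Qed.
Lemma vgt_sum r (I : Type) (s : seq I) (P : pred I) (f : I -> algC) :
  (forall i, P i -> vgt r (f i)) -> vgt r (\sum_(i <- s | P i) f i).
Proof.
by move=> h; elim/big_ind: _ => //; [rewrite /vgt val_zero ltey|exact: vgtD].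
Qed.

Lemma val_addr r x y : v x = r%:E -> vgt r y -> v (x + y) = r%:E.
Proof.
move=> hx hy; apply/eqP; rewrite eq_le andbC; apply/andP; split.
  by apply: vgeD; [rewrite /vge hx|exact: vgt_vge].
rewrite leNgt; apply/negP => h.
have : vgt r (x + y - y) by apply: vgtD => //; rewrite vgtN.
by rewrite addrK /vgt hx ltxx.
Qed.

Lemma vge_nat n : vge 0 n%:R.
Proof.
elim: n => [|n IH]; first exact: vge0.
by rewrite mulrS vgeD // /vge val_one.
Qed.

Lemma vge_int x : x \in Num.int -> vge 0 x.
Proof.
case/intrP => z ->; case: z => n; first exact: vge_nat.
by rewrite NegzE mulrNz vgeN; exact: vge_nat.
Qed.

Lemma val_odd n : odd n -> v n%:R = 0%:E.
Proof.
move=> o; rewrite -(odd_double_half n) o natrD; apply: val_addr; first exact: val_one.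
rewrite -muln2 natrM; apply: (@vge_vgt (0 + 1)); first by rewrite add0r.
by apply: vgeM; [exact: vge_nat|rewrite /vge val_two].
Qed.

Lemma vge_even n : ~~ odd n -> vge 1 n%:R.
Proof.
move=> o; rewrite -(odd_double_half n) (negbTE o) add0n -muln2 natrM -[X in vge X]add0r.
by apply: vgeM; [exact: vge_nat|rewrite /vge val_two].
Qed.

Lemma vge_int_away c x : odd c -> int_away c x -> vge 0 x.
Proof.
move=> oc [t /vge_int]; rewrite /vge val_mul.
suff -> : v (c%:R ^+ t) = 0%:E by rewrite adde0.
by rewrite -natrX val_odd // oddX oc orbT.
Qed.

(** Modulo the maximal ideal (x - 1)^2 = x^2 - 1, by induction on k. *)
Lemma vgt_unity_sub1 (x : algC) k : x ^+ (2 ^ k) = 1 -> vgt 0 (x - 1).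
Proof.
elim: k x => [|k IH] x; first by rewrite expr1 => ->; rewrite subrr /vgt val_zero ltey.
rewrite expnS exprM => /IH h.
have x1 : vge 0 (x - 1).
  have [y yx] : exists y, y = x - 1 by exists (x - 1).
  rewrite -yx; have e : y ^+ 2 + 2 * y = x ^+ 2 - 1 by rewrite yx; ring.
  have [->|y0] := eqVneq y 0; first exact: vge0.
  have [r ry] := val_fin y0; rewrite /vge ry lee_fin leNgt; apply/negP => r0.
  have : v (y ^+ 2 + 2 * y) = (r + r)%:E.
    apply: val_addr; first by rewrite expr2 val_mul ry.
    by rewrite /vgt val_mul val_two ry -EFinD lte_fin; lra.
  by rewrite e => h'; move: h; rewrite /vgt h' lte_fin; lra.
have : vgt 0 ((x - 1) ^+ 2).
  have -> : (x - 1) ^+ 2 = (x ^+ 2 - 1) + (2 * (- (x - 1))) by ring.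
  apply: vgtD => //; apply: vgtM0; first by rewrite /vgt val_two lte_fin.
  by rewrite vgeN.
rewrite /vgt expr2 val_mul; case: (v (x - 1)) => [r| |] //.
by rewrite -EFinD !lte_fin; lra.
Qed.

(** One has 1 - x^2 = (1 - x)(1 + x), and 1 + x = 2 - (1 - x) has the same
    valuation as 1 - x as soon as the latter is less than 1; so each square root
    halves the valuation, starting from 1 - (-1) = 2. *)
Lemma val_sub1_unity k (x : algC) : x ^+ (2 ^ k) = -1 -> v (1 - x) = (2 ^- k)%:E.
Proof.
elim: k x => [|k IH] x; first by rewrite expr1 => ->; rewrite opprK expr0 invr1 val_two.
rewrite expnS exprM => h; have := IH _ h.
have -> : 1 - x ^+ 2 = (1 - x) * (1 + x) by ring.
have [h1|h1] := boolP (vge 1 (1 - x)).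
  have h2 : vge 1 (1 + x).
    have -> : 1 + x = 2 + - (1 - x) by ring.
    by apply: vgeD; rewrite ?vgeN // /vge val_two.
  have := vgeM h1 h2; rewrite /vge => h3 e; move: h3; rewrite e lee_fin.
  have : (2 ^- k : R) <= 1 by rewrite invf_le1 ?exprn_ege1 // ?exprn_gt0 // ler1n.
  by move=> /(le_trans _) h4 /h4; rewrite gerDl ler10.
have x0 : 1 - x != 0 by apply: contraNneq h1 => ->; exact: vge0.
have [r rx] := val_fin x0.
have r1 : r < 1 by move: h1; rewrite /vge rx lee_fin -ltNge.
rewrite val_mul rx.
have -> : v (1 + x) = r%:E.
  have -> : 1 + x = - (1 - x) + 2 by ring.
  by apply: val_addr; rewrite ?val_opp // /vgt val_two lte_fin.
rewrite -EFinD => -[] e; congr (_%:E); rewrite exprS invfM.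
by rewrite -[RHS]mulrC -e; field.
Qed.
End Valuation.

(** * Valuations of smoothed sums of even functions *)

Lemma sum_fold_half (F : zmodType) M (f : nat -> F) : f (M + M)%N = 0 -> f M = 0 ->
  \sum_(a < M + M) f a = \sum_(a < M) (f a + f (M + M - a)%N).
Proof.
move=> f2 f1; rewrite big_split_ord big_split /=; congr (_ + _).
rewrite (reindex_inj rev_ord_inj) /=.
transitivity (\sum_(i < M) f (M + M - i.+1)%N).
  by apply: eq_bigr => i _; congr f; have := ltn_ord i; lia.
case: M f1 f2 => [|M] f1 f2; first by rewrite !big_ord0.
rewrite [RHS]big_ord_recl big_ord_recr /= subn0 f2 add0r addnK f1 addr0.
by [].
Qed.

Lemma count_multiples3 M x : (\sum_(b < M) (3 %| b + x)%N + (x + 2) %/ 3 = (M + x + 2) %/ 3)%N.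
Proof.
elim: M => [|M IH]; first by rewrite big_ord0.
by rewrite big_ord_recr /=; move: IH; case: (boolP (3 %| M + x)%N) => /=; lia.
Qed.

Lemma sum_odd (F : nmodType) M (f : nat -> F) : (forall a, ~~ odd a -> f a = 0) ->
  \sum_(a < M.*2) f a = \sum_(b < M) f b.*2.+1.
Proof.
move=> f0; elim: M => [|M IH]; first by rewrite !big_ord0.
by rewrite doubleS !big_ord_recr /= IH (f0 M.*2) ?odd_double // addr0.
Qed.

(** There are 2^n odd residues, an even number, and the residues with
    3 | 2 b + 1 + 2^(n+2) are odd in number: they are counted by a difference of
    floors whose parity is decided by 2^n modulo 3. *)
Lemma odd_count3 n : (0 < n)%N ->
  odd (\sum_(b < 2 ^ n) ~~ (3 %| b.*2.+1 + 2 ^ n.+2)%N).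
Proof.
move=> n0; have := count_multiples3 (2 ^ n) (2 + 2 * 2 ^ n).
have : (\sum_(b < 2 ^ n) ~~ (3 %| b.*2.+1 + 2 ^ n.+2)%N +
        \sum_(b < 2 ^ n) (3 %| b + (2 + 2 * 2 ^ n))%N = 2 ^ n)%N.
  rewrite -big_split /= -[RHS]card_ord -sum1_card; apply: eq_bigr => b _.
  suff -> : (3 %| b.*2.+1 + 2 ^ n.+2)%N = (3 %| b + (2 + 2 * 2 ^ n))%N.
    by case: (3 %| _)%N.
  by rewrite !expnS; lia.
have : (3 %| 2 ^ n)%N = false by apply/negbTE; rewrite Euclid_dvdX.
case: n n0 => // n _; rewrite expnS; move: (2 ^ n)%N (\sum_(_ < _) _)%N (\sum_(_ < _) _)%N.
by move=> x y z; lia.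
Qed.

Lemma odd_pow_reflect m N a : odd m -> (a <= N)%N ->
  exists2 z : algC, z \in Num.int & (N - a)%:R ^+ m = - a%:R ^+ m + N%:R * z.
Proof.
move=> om aN.
exists (\sum_(i < m) (N - a)%:R ^+ (m.-1 - i) * (- a%:R) ^+ i).
  by rewrite rpred_sum // => i _; rewrite rpredM ?rpredX ?rpredN ?rpred_nat.
have e : (- a%:R) ^+ m = - a%:R ^+ m :> algC.
  by rewrite -mulN1r exprMn -signr_odd om expr1 mulN1r.
apply/eqP; rewrite addrC -subr_eq -e subrXX opprK -natrD subnK //.

Qed.

(** The main term of [dilated_sum] is folded along a |-> N - a, where N = 2 M:
    a^m changes sign modulo N, the smoothing constant changes sign, and rho does not
    change, so the two terms are congruent modulo N. *)
Lemma even_dilated_sum (rho : nat -> algC) M c m w l : (0 < M)%N -> (0 < c)%N ->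
  coprime c (M + M) -> odd m -> seq_periodic (M + M) rho ->
  rho 0 = 0 -> rho M = 0 ->
  (forall a, (a <= M + M)%N -> rho (M + M - a)%N = rho a) ->
  (forall k, rho (c * k)%N = w * rho k) ->
  regsum (fun k => k%:R ^+ m * rho k) l ->
  exists2 e : nat -> algC, (forall a, int_away c (e a)) &
  (1 - w * c%:R ^+ m.+1) * l =
    2 * (\sum_(a < M) rho a * (a%:R ^+ m * smoothing_const c (M + M) a)) +
    (M + M)%:R * (\sum_(a < M + M) rho a * e a).
Proof.
move=> M0 c0 cN om rp r0 rM re rc rl.
have N0 : (0 < M + M)%N by rewrite addn_gt0 M0.
have [e eI ->] := dilated_sum N0 c0 cN rp rc rl.
have [z zP] : {z : nat -> algC & forall a, z a \in Num.int /\
    ((a <= M + M)%N -> (M + M - a)%:R ^+ m = - a%:R ^+ m + (M + M)%:R * z a)}.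
  apply: (@boolp.choice _ _ (fun a y => y \in Num.int /\
    ((a <= M + M)%N -> (M + M - a)%:R ^+ m = - a%:R ^+ m + (M + M)%:R * y))) => a.
  case: (leqP a (M + M)) => aN; last by exists 0; rewrite rpred0.
  by have [y yI yE] := odd_pow_reflect om aN; exists y.
exists (fun a => e a - (if (a < M)%N then smoothing_const c (M + M) a * z a else 0)).
  move=> a; rewrite -mulN1r; apply: int_awayD => //.
  apply: int_awayM; first by apply: int_away_int; rewrite rpredN rpred1.
  case: ifP => _; last by apply: int_away_int; rewrite rpred0.
  apply: int_awayM; first exact: smoothing_const_int_away.
  by apply: int_away_int; case: (zP a).
set s := smoothing_const c (M + M).
transitivity (\sum_(a < M + M) rho a * (a%:R ^+ m * s a) +
    (M + M)%:R * \sum_(a < M + M) rho a * e a).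
  by rewrite mulr_sumr -big_split; apply: eq_bigr => a _ /=; ring.
have -> : \sum_(a < M + M) rho a * (a%:R ^+ m * s a) =
   \sum_(a < M) (2 * (rho a * (a%:R ^+ m * s a)) - (M + M)%:R * (rho a * (s a * z a))).
  have rMM : rho (M + M)%N = 0 by rewrite -[(M + M)%N]add0n rp.
  rewrite (@sum_fold_half _ M (fun a => rho a * (a%:R ^+ m * s a))) ?rM ?rMM ?mul0r //.
  apply: eq_bigr => a _; have aN : (a <= M + M)%N by have := ltn_ord a; lia.
  by rewrite re // (zP a).2 // /s smoothing_const_opp //; ring.
rewrite sumrB -!mulr_sumr -addrA; congr (_ + _).
rewrite addrC -mulrBr; congr (_ * _).
have -> : \sum_(a < M) rho a * (s a * z a) =
   \sum_(a < M + M) rho a * (if (a < M)%N then s a * z a else 0).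
  rewrite big_split_ord /= [X in _ = _ + X]big1 ?addr0; last first.
    by move=> i _; rewrite ltnNge leq_addr mulr0.
  by apply: eq_bigr => a _; rewrite ltn_ord.
by rewrite -sumrB; apply: eq_bigr => a _; rewrite mulrBr.
Qed.

Section Valuation.
Variables (R : realType) (v : algC -> \bar R).
Hypothesis hv : dyadic_valuation v.

(** If the values of rho are divisible by 2, the factor 2 of [even_dilated_sum] gives a
    second power of 2. *)
Lemma vge2_regsum_even (rho : nat -> algC) M c m w l : (0 < M)%N -> ~~ odd M -> odd c ->
  coprime c (M + M) -> odd m -> seq_periodic (M + M) rho ->
  rho 0 = 0 -> rho M = 0 ->
  (forall a, (a <= M + M)%N -> rho (M + M - a)%N = rho a) ->
  (forall k, rho (c * k)%N = w * rho k) ->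
  (forall a, vge v 1 (rho a)) ->
  regsum (fun k => k%:R ^+ m * rho k) l ->
  vge v 2 ((1 - w * c%:R ^+ m.+1) * l).
Proof.
move=> M0 eM oc cN om rp r0 rM re rc r1 rl.
have [e eI ->] := even_dilated_sum M0 (odd_gt0 oc) cN om rp r0 rM re rc rl.
have v2 : vge v 1 2 by rewrite /vge (val_two hv).
have e2 : 2 = 1 + 1 + 0 :> R by ring.
rewrite e2; apply: (vgeD hv).
  rewrite -addrA; apply: (vgeM hv) => //; apply: (vge_sum hv) => a _; apply: (vgeM hv) => //.
  rewrite -[0]addr0; apply: (vgeM hv); first by rewrite -natrX; exact: vge_nat.
  by apply: (vge_int_away hv oc); apply: smoothing_const_int_away; exact: odd_gt0.
rewrite -addrA; apply: (vgeM hv); last first.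
  apply: (vge_sum hv) => a _; apply: (vgeM hv) => //.
  exact: (vge_int_away hv oc).
by apply: vge_even => //; rewrite oddD addbb.
Qed.

(** With x, y, z the values of the smoothing function at a, a + N and
    a + 2 N, whose sum is zero, the constant is (3 x + 2 y + z) / 3, that is
    3 const = 2 (x + y) - y; modulo 2 this is y, and y is 1 or -2. *)
Lemma smoothing_const3_parity N a : coprime 3 N ->
  vge v 1 (smoothing_const 3 N a - (~~ (3 %| a + N)%N)%:R).
Proof.
move=> cN.
have := @smoothing_sum0 3 N isT cN a; rewrite !big_ord_recl big_ord0 /= muln0 addn0 addr0.
rewrite /bump /= muln1 => h0.
have -> : smoothing_const 3 N a - (~~ (3 %| a + N)%N)%:R =
  2 * (smoothing 3 a + smoothing 3 (a + N) - smoothing_const 3 N a) -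
  (smoothing 3 (a + N) + (~~ (3 %| a + N)%N)%:R).
  rewrite /smoothing_const !big_ord_recl !big_ord0 /= muln0 addn0 /bump /= muln1.
  move: h0; move: (smoothing 3 a) (smoothing 3 (a + N)) (smoothing 3 (a + N * _)) => x y z h.
  by have -> : z = - x - y; [rewrite -[LHS]subr0 -h; ring|field].
apply: (vgeD hv).
  rewrite -[1]addr0; apply: (vgeM hv); first by rewrite /vge (val_two hv).
  apply: (vgeD hv).
    by apply: (vgeD hv); apply: (vge_int hv); exact: smoothing_int.
  by rewrite (vgeN hv); apply: (@vge_int_away _ _ hv 3) => //; exact: smoothing_const_int_away.
rewrite (vgeN hv) /smoothing; case: (3 %| a + N)%N => /=.
  have -> : 1 - 3%:R + 0%:R = - 2%:R :> algC by ring.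
  by rewrite (vgeN hv) /vge (val_two hv).
have -> : 1 - 0 + 1%:R = 2%:R :> algC by ring.
by rewrite /vge (val_two hv).
Qed.

(** After removing the factor 2 of [even_dilated_sum], rho(a) and a^m become 1
    modulo the maximal ideal for odd a, and the sum becomes the number of odd
    a < 2^(n+1) with 3 not dividing a + 2^(n+2), which is odd. *)
Lemma val_regsum_odd_support (rho : nat -> algC) n m w l : (0 < n)%N ->
  odd m -> seq_periodic (2 ^ n.+2) rho -> 
  (forall a, ~~ odd a -> rho a = 0) ->
  (forall a, odd a -> rho a ^+ (2 ^ n) = 1) ->
  (forall a, (a <= 2 ^ n.+2)%N -> rho (2 ^ n.+2 - a)%N = rho a) ->
  (forall k, rho (3 * k)%N = w * rho k) ->
  regsum (fun k => k%:R ^+ m * rho k) l ->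
  v ((1 - w * 3%:R ^+ m.+1) * l) = 1%:E.
Proof.
move=> n0 om rp r0 r1 re rc rl.
set M := (2 ^ n.+1)%N.
have eN : (2 ^ n.+2 = M + M)%N by rewrite addnn -muln2 mulnC -expnS.
have eM : M = (2 ^ n).*2 by rewrite -muln2 mulnC -expnS.
have M0 : (0 < M)%N by rewrite expn_gt0.
have evM : ~~ odd M by rewrite eM odd_double.
have cN : coprime 3 (M + M) by rewrite -eN coprimeXr.
rewrite eN in rp re.
have r00 : rho 0 = 0 by apply: r0.
have [e eI ->] := even_dilated_sum M0 (isT : 0 < 3)%N cN om rp r00 (r0 _ evM) re rc rl.
have v2 : vge v 1 2 by rewrite /vge (val_two hv).
have rho0 a : vge v 0 (rho a).
  case: (boolP (odd a)) => oa; last by rewrite r0 //; exact: vge0.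
  by rewrite /vge (val_unity hv _ (r1 _ oa)) ?expn_gt0.
apply: val_addr => //; last first.
  apply: (@vge_vgt _ _ (1 + 1 + 0)); first by lra.
  apply: (vgeM hv).
    rewrite addnn -muln2 natrM; apply: (vgeM hv) => //; exact: vge_even.
  apply: (vge_sum hv) => a _; rewrite -[0]addr0; apply: (vgeM hv) => //.
  exact: (@vge_int_away _ _ hv 3).
rewrite (val_mul hv) (val_two hv) -[RHS]adde0; congr (_ + _)%E.
pose b a : algC := (odd a && ~~ (3 %| a + (M + M))%N)%:R.
have -> : \sum_(a < M) rho a * (a%:R ^+ m * smoothing_const 3 (M + M) a) =
   (\sum_(b < 2 ^ n) ~~ (3 %| b.*2.+1 + 2 ^ n.+2))%N%:R +
   \sum_(a < M) (rho a * (a%:R ^+ m * smoothing_const 3 (M + M) a) - b a).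
  suff -> : (\sum_(b < 2 ^ n) ~~ (3 %| b.*2.+1 + 2 ^ n.+2))%N%:R = \sum_(a < M) b a.
    by rewrite sumrB addrC subrK.
  rewrite [in RHS]eM (@sum_odd _ _ b) /b; last by move=> a /negbTE ->.
  by rewrite natr_sum eN; apply: eq_bigr => i _; rewrite oddS odd_double.
apply: val_addr => //; first by apply: val_odd => //; exact: odd_count3.
apply: (vgt_sum hv) => a _; rewrite /b.
case: (boolP (odd a)) => oa /=; last first.
  by rewrite r0 // mul0r subrr /vgt (val_zero hv) ltey.
set B := (~~ _)%:R; set D := smoothing_const _ _ _.
have -> : rho a * (a%:R ^+ m * D) - B =
   (rho a - 1) * (a%:R ^+ m * D) + (a%:R ^+ m - 1) * D + (D - B) by ring.
have D0 : vge v 0 D by apply: (@vge_int_away _ _ hv 3) => //; exact: smoothing_const_int_away.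
have a0 : vge v 0 (a%:R ^+ m) by rewrite -natrX; exact: vge_nat.
apply: (vgtD hv).
  apply: (vgtD hv).
    apply: (vgtM0 hv); first by apply: (vgt_unity_sub1 hv (r1 _ oa)).
    by rewrite -[0]addr0; apply: (vgeM hv).
  apply: (vgtM0 hv) => //; apply: (@vge_vgt _ _ 1) => //.
  have am : (0 < a ^ m)%N by rewrite expn_gt0 odd_gt0.
  have -> : a%:R ^+ m - 1 = (a ^ m - 1)%:R :> algC by rewrite natrB // natrX.
  by apply: vge_even => //; rewrite oddB // oddX oa orbT.
by apply: (@vge_vgt _ _ 1) => //; exact: smoothing_const3_parity.
Qed.
End Valuation.

(** * The signed prime congruent to 1 modulo 4 *)

Lemma odd_intP (a : int) : odd `|a|%N -> exists t : int, a = 1 + 2 * t.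
Proof. by move=> o; exists ((a - 1) %/ 2)%Z; lia. Qed.

(** Each factor p - i of (p - 1)! is replaced by -i modulo p. *)
Lemma factorial_reflect p k : (k < p)%N -> exists q : int,
  (p.-1)`!%:Z = (-1) ^+ k * k`!%:Z * (p.-1 - k)`!%:Z + p%:Z * q.
Proof.
elim: k => [|k IH] kp.
  by exists 0; rewrite subn0 mulr0 addr0 fact0 expr0 !mul1r.
have [q ->] := IH (ltnW kp).
have -> : (p.-1 - k = (p.-1 - k.+1).+1)%N by lia.
set r := (p.-1 - k.+1)%N.
exists ((-1) ^+ k * k`!%:Z * r`!%:Z + q).
rewrite !factS !PoszM exprS.
have -> : r.+1%:Z = p%:Z - k.+1%:Z by rewrite /r; lia.
by ring.
Qed.

(** Wilson's theorem: ((p-1)/2)! is a square root of -1. *)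
Lemma sqrtN1_mod p : prime p -> (p %% 4 = 1)%N ->
  exists x : nat, (p%:Z %| x%:Z ^+ 2 + 1)%Z.
Proof.
move=> pp p4; pose h := (p.-1)./2.
have p2 := prime_gt1 pp.
have [|q] := @factorial_reflect p h; first by rewrite /h; lia.
have -> : (p.-1 - h = h)%N by rewrite /h; lia.
have -> : (-1) ^+ h = 1 :> int by rewrite -signr_odd (_ : odd h = false) // /h; lia.
rewrite mul1r => e; exists h`!.
have /dvdnP[s hs] : (p %| ((p.-1)`!).+1)%N by rewrite -Wilson.
apply/dvdzP; exists (s%:Z - q).
have -> : h`!%:Z ^+ 2 = (p.-1)`!%:Z - p%:Z * q by rewrite e; ring.
have -> : (p.-1)`!%:Z = s%:Z * p%:Z - 1 by rewrite -PoszM -hs; lia.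
by ring.
Qed.

(** If x^2 = -1 then x^(p-1) = -1 because (p - 1) / 2 is odd, contradicting
    Fermat's little theorem. *)
Lemma no_sqrtN1_mod p x : prime p -> (p %% 4 = 3)%N -> ~ (p%:Z %| x%:Z ^+ 2 + 1)%Z.
Proof.
move=> pp p4 dv; pose h := (p.-1)./2.
have e : p = (h * 2).+1 by rewrite /h; have := prime_gt1 pp; lia.
have h1 : (p%:Z %| x%:Z ^+ p.-1 + 1)%Z.
  have -> : p.-1 = (2 * h)%N by rewrite {1}e mulnC.
  have oh : odd h by rewrite /h; lia.
  have -> : x%:Z ^+ (2 * h) + 1 = (x%:Z ^+ 2) ^+ h - (-1) ^+ h.
    by rewrite -signr_odd oh expr1 opprK exprM.
  by rewrite subrXX opprK dvdz_mulr.
have h2 : (p%:Z %| x%:Z ^+ p - x%:Z)%Z.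
  rewrite -eqz_mod_dvd; have -> : x%:Z ^+ p = (x ^ p)%N%:Z by rewrite -[RHS]natz natrX natz.
  by apply/eqP; rewrite !modz_nat fermat_little.
have h3 : (p%:Z %| 2 * x%:Z)%Z.
  have -> : 2 * x%:Z = x%:Z * (x%:Z ^+ p.-1 + 1) - (x%:Z ^+ p - x%:Z).
    by rewrite -[in x%:Z ^+ p](prednK (prime_gt0 pp)) exprS; ring.
  by rewrite rpredB ?dvdz_mull.
move: h3; rewrite -[2]/(2%:Z) -PoszM dvdzE !absz_nat Euclid_dvdM // => /orP[/dvdn_leq|px].
  by move=> /(_ isT); have := prime_gt1 pp; lia.
move: dv; rewrite -natz -natrX natz dvdzE -[_ + 1]/((x ^ 2 + 1)%N%:Z) !absz_nat.
by rewrite dvdn_addr ?dvdn1 ?dvdn_exp //; case: eqP pp => // ->.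
Qed.

Lemma pstar_cases p : prime p -> odd p ->
  (pstar p = p%:Z \/ pstar p = - p%:Z) /\ (4 %| pstar p - 1)%Z.
Proof.
move=> pp op; have p2 := prime_gt1 pp.
have nd : (p%:Z %| -1)%Z = false by rewrite dvdzE /= dvdn1; lia.
rewrite /pstar /legendre nd.
have p4 : (p %% 4 = 1 \/ p %% 4 = 3)%N by lia.
have modE (x : int) : ((x ^+ 2 == -1 %[mod p%:Z]) = (p%:Z %| x ^+ 2 + 1))%Z.
  by rewrite eqz_mod_dvd opprK.
case: p4 => p4.
  have [x hx] := sqrtN1_mod pp p4.
  have xp : (x %% p < p)%N by rewrite ltn_mod; lia.
  have -> : [exists x : 'I_p, (x%:Z ^+ 2 == -1 %[mod p%:Z])%Z].
    apply/existsP; exists (Ordinal xp); rewrite modE /=.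
    have -> : (x %% p)%N%:Z = x%:Z - p%:Z * (x %/ p)%N%:Z.
      by rewrite {2}(divn_eq x p); lia.
    set y := (x %/ p)%N%:Z.
    have -> : (x%:Z - p%:Z * y) ^+ 2 + 1 = (x%:Z ^+ 2 + 1) + p%:Z * (p%:Z * y ^+ 2 - 2 * x%:Z * y).
      by ring.
    by rewrite rpredD // dvdz_mulr.
  rewrite mul1r; split; first by left.
  by apply/dvdzP; exists (p %/ 4)%N%:Z; lia.
have -> : [exists x : 'I_p, (x%:Z ^+ 2 == -1 %[mod p%:Z])%Z] = false.
  by apply/negbTE/existsP => -[x]; rewrite modE; exact: no_sqrtN1_mod.
rewrite mulN1r; split; first by right.
by apply/dvdzP; exists (- (p %/ 4)%N%:Z - 1); lia.
Qed.

Lemma pstar_dyadic p : prime p -> odd p ->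
  exists t : int, pstar p = 1 + 2 ^+ (fexp p + 2) * (1 + 2 * t).
Proof.
move=> pp op; have [pc /dvdzP[u hu]] := pstar_cases pp op.
have p2 := prime_gt1 pp.
have u0 : u != 0 by apply/eqP => u0; move: hu; rewrite u0 mul0r; case: pc => ->; lia.
have uE : ((pstar p - 1) %/ 4)%Z = u by rewrite hu mulzK.
rewrite /fexp uE.
have /(pfactor_coprime (isT : prime 2)) [w cw uw] : (0 < `|u|)%N by rewrite absz_gt0.
have ow : odd w by rewrite -coprime2n.
set f := logn 2 `|u|%N in uw *.
have [z oz uz] : exists2 z : int, odd `|z|%N & u = 2 ^+ f * z.
  have e2 : (2 ^ f)%N%:Z = 2 ^+ f :> int by rewrite -natz natrX.
  have [u1|u1] := lerP 0 u.
    by exists w%:Z; rewrite ?absz_nat // -e2 -(gez0_abs u1) uw PoszM mulrC.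
  exists (- w%:Z); first by rewrite abszN absz_nat.
  by rewrite -e2 -[LHS]opprK -(ltz0_abs u1) uw PoszM mulrN mulrC.
have [t zt] := odd_intP oz; exists t.
by rewrite -zt -[LHS](subrK 1) hu uz exprD; ring.
Qed.

(** * Values of the characters of the cyclotomic layers *)

Lemma dirichlet_character_mod N chi (a b t : int) : dirichlet_character N chi ->
  a = b + N%:Z * t -> chi a = chi b.
Proof.
move=> [_ per _ _ _] ->.
have H (k : nat) x : chi (x + N%:Z * k%:Z) = chi x.
  elim: k x => [|k IH] x; first by rewrite mulr0 addr0.
  by rewrite -addn1 PoszD mulrDr mulr1 addrA per IH.
case: t => k; first exact: H.
rewrite NegzE -(H k.+1); congr chi.
by rewrite -addrA -mulrDr addNr mulr0 addr0.
Qed.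

Lemma coprimez_pow2 k (a : int) : coprimez a (2 ^ k.+1)%:Z = odd `|a|%N.
Proof. by rewrite coprimezE absz_nat coprime_pexpr // coprimen2. Qed.

Section LayerCharacter.
Variables (n : nat) (chi : int -> algC).
Hypotheses (hchi : primitive_layer_character n chi).

Let chiD : dirichlet_character (2 ^ n.+2) chi. Proof. by case: hchi => -[]. Qed.

Lemma layerM a b : chi (a * b) = chi a * chi b. Proof. by case: chiD. Qed.
Lemma layer1 : chi 1 = 1. Proof. by case: chiD. Qed.
Lemma layerX a k : chi (a ^+ k) = chi a ^+ k.
Proof. by elim: k => [|k IH]; rewrite ?layer1 // !exprS layerM IH. Qed.
Lemma layerN a : chi (- a) = chi a.
Proof. by case: hchi => _ e _; rewrite -mulN1r layerM e mul1r. Qed.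

Lemma layer_neq0 a : (chi a != 0) = odd `|a|%N.
Proof. by case: chiD => _ _ _ _ ->; rewrite coprimez_pow2. Qed.

Lemma layer_even a : ~~ odd `|a|%N -> chi a = 0.
Proof. by rewrite -layer_neq0 negbK => /eqP. Qed.

Lemma layer_order a : odd `|a|%N -> chi a ^+ (2 ^ n) = 1.
Proof. by case: hchi => _ _ [_ h _] o; apply: h; rewrite coprimez_pow2. Qed.

(** If the value at 1 + 2^(n+1) were 1, chi would be periodic modulo 2^(n+1),
    against primitivity; and the square of 1 + 2^(n+1) is 1 modulo 2^(n+2). *)
Lemma layer_conductor : chi (1 + 2 ^+ n.+1) = -1.
Proof.
have sq : chi (1 + 2 ^+ n.+1) ^+ 2 = 1.
  rewrite -layerX -layer1; apply: (@dirichlet_character_mod _ _ _ _ (1 + 2 ^+ n) chiD).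
  by rewrite -natz natrX !exprS; ring.
move/eqP: (sq); rewrite sqrf_eq1 => /orP[/eqP h|/eqP //].
exfalso; have [[_ prim] _ _] := hchi.
have : (2 ^ n.+1 = 2 ^ n.+2)%N.
  apply: (prim _ chi) => //; first by rewrite dvdn_exp2l.
  case: chiD => _ _ c1 cM cN; split=> //; first by rewrite expn_gt0.
  - move=> a; have [oa|ea] := boolP (odd `|a|%N); last first.
      rewrite (layer_even ea) layer_even //.
      by rewrite !expnS; lia.
    have [t ta] := odd_intP oa.
    rewrite -[RHS]mulr1 -h -layerM; apply: (@dirichlet_character_mod _ _ _ _ (- t) chiD).
    by rewrite ta -!natz !natrX !exprS; ring.
  - by move=> a; rewrite cN !coprimez_pow2.
by apply/eqP; rewrite eqn_exp2l // neq_ltn ltnSn.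
Qed.

(** Squaring 1 + 2^e u with u odd and e >= 2 gives 1 + 2^(e+1) u' with u' odd,
    so k squarings lead to the case of [layer_conductor]. *)
Lemma layer_value (t : int) e k : (2 <= e)%N -> (e + k = n.+1)%N ->
  chi (1 + 2 ^+ e * (1 + 2 * t)) ^+ (2 ^ k) = -1.
Proof.
elim: k e t => [|k IH] e t e2 ek.
  rewrite expn0 expr1 -layer_conductor; apply: (@dirichlet_character_mod _ _ _ _ t chiD).
  have -> : e = n.+1 by rewrite -ek addn0.
  by rewrite -natz natrX !exprS; ring.
rewrite expnS exprM -layerX.
have -> : (1 + 2 ^+ e * (1 + 2 * t)) ^+ 2 =
   1 + 2 ^+ e.+1 * (1 + 2 * (t + 2 ^+ (e - 2) * (1 + 2 * t) ^+ 2)) :> int.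
  by rewrite -{1 2}(subnK e2) -addSn !exprS !exprD; ring.
by apply: IH; lia.
Qed.
End LayerCharacter.

(** * Quadratic characters and Euler factors *)

Section QuadraticCharacter.
Variables (d : nat) (psi : int -> algC).
Hypotheses (d0 : (0 < d)%N) (hpsi : quadratic_character d psi).

Let D := quadratic_disc d.
Let psiD : dirichlet_character D psi. Proof. by case: hpsi => -[]. Qed.
Let D0 : (0 < D)%N. Proof. by case: psiD. Qed.

Lemma quadratic_disc_dvd : (D %| 4 * d)%N.
Proof. by rewrite /D /quadratic_disc; case: ifP => // _; exact: dvdn_mull. Qed.

Lemma quadratic_charM a b : psi (a * b) = psi a * psi b. Proof. by case: psiD. Qed.

Lemma quadratic_char_mod a b t : a = b + (4 * d)%N%:Z * t -> psi a = psi b.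
Proof.
have /dvdnP[q ->] := quadratic_disc_dvd; rewrite PoszM mulrAC mulrC => e.
exact: (dirichlet_character_mod psiD e).
Qed.

Lemma quadratic_char_odd_neq0 (a : int) : odd `|a|%N -> (psi a != 0) = coprime `|a| d.
Proof.
move=> oa; case: psiD => _ _ _ _ ->.
rewrite coprimezE absz_nat /D /quadratic_disc; case: ifP => // _.
by rewrite coprimeMr -[4%N]/(2 ^ 2)%N coprime_pexpr // coprimen2 oa.
Qed.

Lemma sqrtd_neq0 : sqrtC d%:R != 0 :> algC.
Proof. by rewrite sqrtC_eq0 pnatr_eq0 -lt0n. Qed.

(** An automorphism raising roots of unity to the power a multiplies sqrt d by
    psi(a) and fixes d. *)
Lemma quadratic_char_sqr a : psi a != 0 -> psi a ^+ 2 = 1.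
Proof.
case: (psiD) => _ _ _ _ ->; move=> cop; have [_ hs] := hpsi.
pose k := `|(a %% D%:Z)%Z|%N.
have kE : k%:Z = (a %% D%:Z)%Z by rewrite gez0_abs // modz_ge0 // eqz_nat -lt0n.
have ck : coprime k D.
  by move: cop; rewrite -[D in coprime _ D]absz_nat -[k]absz_nat -coprimezE kE /coprimez gcdz_modl.
have [s sP] := Qn_aut_exists ck.
have := hs s a cop; move=> /(_ _)/(congr1 (fun x => x ^+ 2)).
rewrite -rmorphXn exprMn sqrtCK rmorph_nat => h.
have /h e : forall z : algC, z ^+ quadratic_disc d = 1 -> s z = z ^ a.
  move=> z zD; rewrite sP // (divz_eq a D%:Z) -kE.
  have z0 : z != 0.
    by apply: contraTneq (oner_neq0 algC) => z0; rewrite -zD z0 expr0n eqn0Ngt D0 eqxx.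
  by rewrite expfzDr // mulrC [(_ * D%:Z)]mulrC -exprz_exp -[z ^ D%:Z]/(z ^+ D) zD exp1rz mulr1.
apply: (mulIf (_ : d%:R != 0 :> algC)); first by rewrite pnatr_eq0 -lt0n.
by rewrite -e mul1r.
Qed.

(** Complex conjugation inverts roots of unity and fixes the real number
    sqrt d. *)
Lemma quadratic_char_even : psi (-1) = 1.
Proof.
have [_ hs] := hpsi.
have cop : coprimez (-1) (quadratic_disc d)%:Z by rewrite coprimezE coprime1n.
have := hs (Num.conj : {rmorphism algC -> algC}) (-1) cop.
have -> : (Num.conj : {rmorphism algC -> algC}) (sqrtC d%:R) = sqrtC d%:R.
  by rewrite /= conj_Creal // realE sqrtC_ge0 ler0n.
move=> h; apply: (mulIf sqrtd_neq0); rewrite mul1r -h // => z zD /=.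
have : `|z| == 1 by rewrite -(pexpr_eq1 D0) // -normrX zD normr1.
by rewrite -[z ^ -1]/(z^-1) invC_norm => /eqP ->; rewrite expr1n invr1 mul1r.
Qed.
End QuadraticCharacter.

Section EulerFactors.
Variables (F : fieldType) (m : nat) (chi : nat -> F).
Hypothesis chiM : forall a b, chi (a * b)%N = chi a * chi b.

(** Removing the multiples of p subtracts the progression of multiples of p,
    on which rho(p j) (p j)^m = rho(p) p^m rho(j) j^m. *)
Lemma regsum_coprime (s : seq nat) l : uniq s -> all prime s ->
  regsum (fun k => k%:R ^+ m * chi k) l ->
  regsum (fun k => k%:R ^+ m * (chi k * (all (fun p => ~~ (p %| k)%N) s)%:R))
    (l * \prod_(p <- s) (1 - chi p * p%:R ^+ m)).
Proof.
elim: s => [|p s IH] /=.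
  by move=> _ _; rewrite big_nil mulr1; apply: regsum_ext => k; rewrite mulr1.
move=> /andP[ps us] /andP[pp als] /(IH us als) h.
rewrite big_cons; set P := \prod_(_ <- _) _ in h *.
have -> : l * ((1 - chi p * p%:R ^+ m) * P) = l * P + (- (chi p * p%:R ^+ m)) * (l * P).
  by ring.
have := regsum_progression 0 (prime_gt0 pp) (regsumZ (- (chi p * p%:R ^+ m)) h).
move/(regsumD h); apply: regsum_ext => k; rewrite subn0 /=.
case: (boolP (p %| k)%N) => [/dvdnP[j ->]|_] /=; last by rewrite addr0.
rewrite mulnK ?prime_gt0 // chiM natrM exprMn.
have -> : all (fun p0 => ~~ (p0 %| j * p)%N) s = all (fun p0 => ~~ (p0 %| j)%N) s.
  apply: eq_in_all => q qs.
  have qp : (q %| p)%N = false.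
    rewrite dvdn_prime2 ?(allP als _ qs) //.
    by apply: contraNF ps => /eqP <-.
  by rewrite Euclid_dvdM ?(allP als _ qs) // qp orbF.
by ring.
Qed.
End EulerFactors.

Lemma coprime_all_primes k d : (0 < d)%N ->
  coprime k d = all (fun p => ~~ (p %| k)%N) (primes d).
Proof.
move=> d0; case: (posnP k) => [->|k0].
  have [->|d1] := eqVneq d 1%N; first by rewrite coprimen1.
  rewrite /coprime gcd0n (negbTE d1); apply/esym/negbTE/allPn.
  by exists (pdiv d); rewrite ?dvdn0 // mem_primes pdiv_prime ?d0 ?pdiv_dvd //; lia.
rewrite coprime_has_primes // -all_predC; apply/eq_in_all => p.
by rewrite mem_primes => /and3P[pp _ _]; rewrite /= mem_primes pp k0.
Qed.

(** * The valuation of the twisted regularized sum *)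

Lemma unity_neq1 (x : algC) k : x ^+ (2 ^ k) = -1 -> x != 1.
Proof.
move=> h; apply/eqP => x1; move/eqP: h; rewrite x1 expr1n -addr_eq0.
by rewrite -[_ + _]/(2%:R) pnatr_eq0.
Qed.
(** The power of b is odd, so 1 - x b^j differs from 1 - x by a multiple
    of 2, whereas 1 - x has valuation less than 1 because k > 0. *)
Lemma val_one_sub (R : realType) (v : algC -> \bar R) (hv : dyadic_valuation v)
    k (x : algC) b j :
    (0 < k)%N -> x ^+ (2 ^ k) = -1 -> odd b ->
  v (1 - x * b%:R ^+ j) = (2 ^- k)%:E.
Proof.
move=> k0 xk ob.
have -> : 1 - x * b%:R ^+ j = (1 - x) + x * (- (b%:R ^+ j - 1)) by ring.
apply: val_addr => //; first exact: val_sub1_unity.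
have x0 : vge v 0 x.
  rewrite /vge (@val_unity _ _ hv x (2 ^ k.+1)) ?expn_gt0 //.
  by rewrite expnS mulnC exprM xk sqrrN expr1n.
apply: (@vge_vgt _ _ (0 + 1)).
  by rewrite add0r invf_lt1 ?exprn_gt0 // exprn_egt1 // ?ltr1n // -lt0n.
apply: (vgeM hv) => //; rewrite (vgeN hv).
have bj : (0 < b ^ j)%N by rewrite expn_gt0 odd_gt0.
have -> : b%:R ^+ j - 1 = (b ^ j - 1)%:R :> algC by rewrite natrB // natrX.
by apply: vge_even => //; rewrite oddB // oddX ob orbT.
Qed.

Section LayerNat.
Variables (n : nat) (chi : int -> algC).
Hypotheses (n1 : (0 < n)%N) (hchi : primitive_layer_character n chi).

Let chiD : dirichlet_character (2 ^ n.+2) chi. Proof. by case: hchi => -[]. Qed.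

Lemma layer_3 : chi 3 ^+ (2 ^ n.-1) = -1.
Proof.
rewrite -(layerN hchi) -(@layer_value _ _ hchi (-1) 2 n.-1) //; last by lia.
Qed.

(** Since chi is even, chi(p) = chi(pstar p), and pstar p = 1 + 2^(f_p + 2) u with
    u odd. *)
Lemma layer_prime p : prime p -> odd p -> (fexp p < n)%N ->
  chi p%:Z ^+ (2 ^ (n.-1 - fexp p)) = -1.
Proof.
move=> pp op fn; have [t ht] := pstar_dyadic pp op.
have -> : chi p%:Z = chi (pstar p).
  by have [[->|->] _] := pstar_cases pp op; rewrite ?(layerN hchi).
by rewrite ht; apply: (layer_value hchi); lia.
Qed.

Lemma layer_1_4d d : odd d -> chi (1 + 4 * d%:Z) ^+ (2 ^ n.-1) = -1.
Proof.
move=> od; have [t ->] : exists t : int, d%:Z = 1 + 2 * t by apply: odd_intP.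
by rewrite -(@layer_value _ _ hchi t 2 n.-1) //; lia.
Qed.

Lemma layer_reflect K a : (2 ^ n.+2 %| K)%N -> (a <= K)%N -> chi (K - a)%N%:Z = chi a%:Z.
Proof.
move=> /dvdnP[q ->] aN; rewrite -[RHS](layerN hchi).
by apply: (@dirichlet_character_mod _ _ _ _ q%:Z chiD); rewrite -subzn // PoszM; ring.
Qed.

(** Smoothing with c = 3: the smoothed sum has valuation 1 and the factor
    1 - chi(3) 3^(m+1) has valuation 2^(1-n). This is the case d = 1. *)
Lemma val_layer (R : realType) (v : algC -> \bar R) (hv : dyadic_valuation v) m l :
  odd m -> regsum (fun k => k%:R ^+ m * chi k%:Z) l -> (1 < n)%N ->
  v l = (1 - 2 ^- n.-1)%:E.
Proof.
move=> om hl n2.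
have rp : seq_periodic (2 ^ n.+2) (fun k => chi k%:Z).
  by move=> k; apply: (@dirichlet_character_mod _ _ _ _ 1 chiD); rewrite mulr1 PoszD.
have h : v ((1 - chi 3 * 3%:R ^+ m.+1) * l) = 1%:E.
  apply: (@val_regsum_odd_support _ _ hv (fun k => chi k%:Z) n) => //.
  - by move=> a ea; apply: (layer_even hchi).
  - by move=> a oa; apply: (layer_order hchi).
  - by move=> a; apply: layer_reflect.
  - by move=> k; rewrite PoszM (layerM hchi).
move: h; rewrite (val_mul hv) (@val_one_sub _ _ hv n.-1) //; [|lia|exact: layer_3].
case: (v l) => [r| |] //; rewrite -EFinD => -[e].
by congr (_%:E); apply/eqP; rewrite eq_sym subr_eq addrC e.
Qed.

End LayerNat.

Section TwistedCharacter.
Variables (n d : nat) (chi psi : int -> algC).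
Hypotheses (n1 : (0 < n)%N) (d0 : (0 < d)%N) (od : odd d).
Hypotheses (hpsi : quadratic_character d psi) (hchi : primitive_layer_character n chi).

Let chiD : dirichlet_character (2 ^ n.+2) chi. Proof. by case: hchi => -[]. Qed.

Definition twist_period := (2 ^ n.+2 * d)%N.
Let N := twist_period.
Let M := (2 ^ n.+1 * d)%N.

Lemma twist_period_gt0 : (0 < N)%N. Proof. by rewrite muln_gt0 expn_gt0. Qed.
Let NE : N = (M + M)%N. Proof. by rewrite /N /twist_period /M expnS; lia. Qed.

Let coprime_c : coprime (1 + 4 * d) N.
Proof.
rewrite coprimeMr; apply/andP; split.
  by rewrite coprimeXr // coprimen2 oddD oddM.
by rewrite /coprime gcdnC addnC gcdnMDl gcdn1.
Qed.

Lemma layer_mod_twist (a b t : int) : a = b + N%:Z * t -> chi a = chi b.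
Proof.
by rewrite /N /twist_period PoszM -mulrA => h; apply: (dirichlet_character_mod chiD h).
Qed.

Lemma quadratic_char_mod_twist (a b t : int) : a = b + N%:Z * t -> psi a = psi b.
Proof.
rewrite /N /twist_period !expnS => h; apply: (@quadratic_char_mod d psi hpsi a b ((2 ^ n)%N%:Z * t)).
by rewrite h; lia.
Qed.

Lemma twist_periodic : seq_periodic N (fun k => chi k%:Z * psi k%:Z).
Proof.
by move=> k; rewrite PoszD; congr (_ * _); 
  [apply: (layer_mod_twist (t := 1))|apply: (quadratic_char_mod_twist (t := 1))];
  rewrite mulr1.
Qed.

Lemma twist_mean_zero : mean_zero N (fun k => chi k%:Z * psi k%:Z).
Proof.
split; first exact: twist_periodic.
apply: (@mean_zero_periodic _ N (1 + 4 * d) (fun k => chi k%:Z * psi k%:Z)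
  (chi (1 + 4 * d%:Z)) twist_period_gt0).
- exact: coprime_c.
- exact: twist_periodic.
- move=> k; rewrite PoszM PoszD PoszM (layerM hchi) (quadratic_charM hpsi).
  rewrite (_ : psi (1 + 4%N%:Z * d%:Z) = 1) ?mul1r ?mulrA //.
  rewrite -(_ : psi 1 = 1); last by have [[[]]] := hpsi.
  by apply: (@quadratic_char_mod d psi hpsi _ _ 1); rewrite PoszM mulr1.
- exact: unity_neq1 (layer_1_4d n1 hchi od).
Qed.

Variables (R : realType) (v : algC -> \bar R).
Hypothesis hv : dyadic_valuation v.

(** On odd integers psi is congruent modulo 2 to the indicator of the integers
    prime to d. The smoothing modulus c = 1 + 4 d is chosen so that psi(c) = 1,
    which makes both functions satisfy the same relation rho(c k) = chi(c) rho(k),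
    and so that chi(c) has order 2^n. *)
Lemma val_twist_diff m l1 l2 : odd m ->
  regsum (fun k => k%:R ^+ m * (chi k%:Z * psi k%:Z)) l1 ->
  regsum (fun k => k%:R ^+ m * (chi k%:Z * (coprime k d)%:R)) l2 -> (1 < n)%N ->
  vge v (2 - 2 ^- n.-1) (l1 - l2).
Proof.
move=> om h1 h2 n2.
pose rho k : algC := chi k%:Z * psi k%:Z - chi k%:Z * (coprime k d)%:R.
have rhoE k : rho k = chi k%:Z * (psi k%:Z - (coprime k d)%:R) by rewrite /rho; ring.
have cd_mod (a b : nat) : (d %| a + b)%N -> coprime a d = coprime b d.
  have H x y : (d %| x + y)%N -> (gcdn x d %| gcdn y d)%N.
    move=> xy; rewrite dvdn_gcd dvdn_gcdr andbT.
    by rewrite -(dvdn_addr y (dvdn_gcdl x d)) (dvdn_trans (dvdn_gcdr x d)).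
  by move=> ab; rewrite /coprime; congr (_ == _); apply/eqP; rewrite eqn_dvd !H // addnC.
have h : vge v 2 ((1 - chi (1 + 4 * d%:Z) * (1 + 4 * d)%N%:R ^+ m.+1) * (l1 - l2)).
  apply: (@vge2_regsum_even _ _ hv rho M) => //.
  - by rewrite muln_gt0 expn_gt0.
  - by rewrite oddM oddX.
  - by rewrite oddD oddM.
  - by rewrite -NE.
  - rewrite -NE => k; rewrite !rhoE (layer_mod_twist (b := k%:Z) (t := 1)) ?mulr1 ?PoszD //.
    rewrite (quadratic_char_mod_twist (b := k%:Z) (t := 1)) ?mulr1 ?PoszD //.
    by rewrite -coprime_modl addnC modnMDl coprime_modl.
  - by rewrite rhoE (layer_even hchi) ?mul0r.
  - by rewrite rhoE (layer_even hchi) ?mul0r //= oddM oddX.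
  - move=> a; rewrite -NE => aN; rewrite !rhoE (layer_reflect hchi) //; last exact: dvdn_mulr.
    congr (_ * (_ - _)).
      rewrite -[RHS]mul1r -(quadratic_char_even d0 hpsi) -(quadratic_charM hpsi) mulN1r.
      by apply: (quadratic_char_mod_twist (t := 1)); rewrite -subzn // mulr1 addrC.
    congr (_%:R); congr nat_of_bool; apply: cd_mod.
    by rewrite subnK // dvdn_mull.
  - move=> k; rewrite !rhoE PoszM PoszD PoszM (layerM hchi) (quadratic_charM hpsi).
    rewrite (_ : psi (1 + 4%N%:Z * d%:Z) = 1); last first.
      rewrite -(_ : psi 1 = 1); last by have [[[]]] := hpsi.
      by apply: (@quadratic_char_mod d psi hpsi _ _ 1); rewrite PoszM mulr1.
    rewrite mul1r mulrA; congr (_ * (_ - _%:R)).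
    rewrite coprimeMl (_ : coprime (1 + 4 * d) d = true) //.
    by rewrite /coprime gcdnC addnC gcdnMDl gcdn1.
  - move=> a; rewrite rhoE; case: (boolP (odd a)) => oa; last first.
      by rewrite (layer_even hchi) // mul0r; exact: vge0.
    have e1 : 1 = 0 + 1 :> R by rewrite add0r.
    rewrite e1; apply: (vgeM hv).
      by rewrite /vge (@val_unity _ _ hv _ (2 ^ n)) ?expn_gt0 // (layer_order hchi).
    have := quadratic_char_odd_neq0 hpsi (oa : odd `|a%:Z|%N); rewrite absz_nat.
    case: (coprime a d) => /=; last by move/negbFE/eqP ->; rewrite subrr; exact: vge0.
    move/(quadratic_char_sqr d0 hpsi)/eqP; rewrite sqrf_eq1 => /orP[] /eqP ->.
      by rewrite subrr; exact: vge0.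
    rewrite -opprD (vgeN hv); exact: (@vge_even _ _ hv 2).
  - have := regsumD h1 (regsumZ (-1) h2); rewrite mulN1r; apply: regsum_ext => k.
    by rewrite /rho; ring.
move: h; rewrite /vge (val_mul hv) (@val_one_sub _ _ hv n.-1) //; last first.
- by rewrite oddD oddM.
- exact: layer_1_4d.
- lia.
case: (v (l1 - l2)) => [r| |]; [|by move=> _; exact: leey|by rewrite addeNy leeNy_eq].
by rewrite -EFinD !lee_fin lerBlDl => h.
Qed.
End TwistedCharacter.

Lemma layer_mean_zero n chi : (0 < n)%N -> primitive_layer_character n chi ->
  mean_zero (2 ^ n.+2) (fun k => chi k%:Z).
Proof.
move=> n1 hchi; have [[chiD _] _ _] := hchi.
have per : seq_periodic (2 ^ n.+2) (fun k => chi k%:Z).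
  by move=> k; apply: (@dirichlet_character_mod _ _ _ _ 1 chiD); rewrite mulr1 PoszD.
split=> //; apply: (@mean_zero_periodic _ (2 ^ n.+2) 3 (fun k => chi k%:Z) (chi 3)) => //.
- by rewrite expn_gt0.
- by rewrite coprimeXr.
- by move=> k; rewrite PoszM (layerM hchi).
- exact: unity_neq1 (layer_3 n1 hchi).
Qed.

Lemma val_prod_euler (R : realType) (v : algC -> \bar R) n chi (m : nat) (s : seq nat) :
  dyadic_valuation v -> primitive_layer_character n chi ->
  (forall p, p \in s -> [/\ prime p, odd p & (fexp p < n.-1)%N]) ->
  v (\prod_(p <- s) (1 - chi p%:Z * p%:R ^+ m)) =
  (2 ^- n.-1 * \sum_(p <- s) 2 ^+ fexp p)%:E.
Proof.
move=> hv hchi; elim: s => [|p s IH] hs; first by rewrite !big_nil mulr0 (val_one hv).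
rewrite !big_cons (val_mul hv) IH; last by move=> q qs; apply: hs; rewrite inE qs orbT.
have [pp op fp] := hs p (mem_head _ _).
have fn : (fexp p < n)%N by lia.
have n1 : (0 < n)%N by lia.
have k0 : (0 < n.-1 - fexp p)%N by rewrite subn_gt0.
rewrite (val_one_sub hv m k0 (layer_prime n1 hchi pp op fn) op).
rewrite -EFinD; congr (_%:E); rewrite mulrDr; congr (_ + _).
by rewrite -{2}(subnK (ltnW fp)) exprD invfM -mulrA mulVf ?mulr1 ?expf_neq0.
Qed.

(** The Euler factors at the primes p | d have valuation 2^(1-n) 2^(f_p), and
    the error of [val_twist_diff] has valuation at least 2 - 2^(1-n), which exceeds
    the valuation of the main term once 2^(n-1) is larger than the sum of the
    2^(f_p). *)
Theorem val_regsum_twist (R : realType) (v : algC -> \bar R) n d chi psi m l :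
  dyadic_valuation v -> odd d -> quadratic_character d psi ->
  primitive_layer_character n chi ->
  (2 + \sum_(p <- primes d) 2 ^ fexp p <= n)%N -> odd m ->
  regsum (fun k => k%:R ^+ m * (chi k%:Z * psi k%:Z)) l ->
  v l = (1 + 2 ^ (1 - n%:Z) * (-1 + \sum_(p <- primes d) 2 ^+ fexp p))%:E.
Proof.
move=> hv od hpsi hchi hn om hl.
have d0 := odd_gt0 od; have n2 : (1 < n)%N by lia.
have n1 : (0 < n)%N by lia.
set S := (\sum_(p <- primes d) 2 ^ fexp p)%N in hn.
have hp p : p \in primes d -> [/\ prime p, odd p & (fexp p < n.-1)%N].
  move=> pd; have := pd; rewrite mem_primes => /and3P[pp _ dv]; split=> //.
    by move: od; case/dvdnP: dv => q ->; rewrite oddM => /andP[].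
  have : (2 ^ fexp p <= S)%N by rewrite /S (big_rem p) //= leq_addr.
  by have := ltn_expl (fexp p) (isT : 1 < 2)%N; lia.
have N0 : (0 < 2 ^ n.+2)%N by rewrite expn_gt0.
have [l0 hl0] := mean_zero_regsum_poly 'X^m N0 (layer_mean_zero n1 hchi).
have {}hl0 : regsum (fun k => k%:R ^+ m * chi k%:Z) l0.
  by apply: regsum_ext hl0 => k; rewrite hornerXn mulrC.
have chiM a b : chi (a * b)%N%:Z = chi a%:Z * chi b%:Z by rewrite PoszM (layerM hchi).
have ps : all prime (primes d) by apply/allP => p; rewrite mem_primes => /and3P[].
have hl2 := regsum_coprime chiM (primes_uniq d) ps hl0.
set l2 := l0 * _ in hl2.
have {}hl2 : regsum (fun k => k%:R ^+ m * (chi k%:Z * (coprime k d)%:R)) l2.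
  by apply: regsum_ext hl2 => k; rewrite coprime_all_primes.
have hd := val_twist_diff n1 d0 od hpsi hchi hv om hl hl2 n2.
have S_E : \sum_(p <- primes d) 2 ^+ fexp p = S%:R :> R.
  by rewrite /S natr_sum; apply: eq_bigr => p _; rewrite natrX.
have vl2 : v l2 = (1 - 2 ^- n.-1 + 2 ^- n.-1 * S%:R)%:E.
  by rewrite /l2 (val_mul hv) (val_layer n1 hchi hv om hl0 n2) (val_prod_euler m hv hchi hp) S_E.
have pE : 2 ^ (1 - n%:Z) = 2 ^- n.-1 :> R.
  by rewrite exprnN; congr (_ ^ _); lia.
have -> : 1 + 2 ^ (1 - n%:Z) * (-1 + \sum_(p <- primes d) 2 ^+ fexp p) =
   1 - 2 ^- n.-1 + 2 ^- n.-1 * S%:R :> R by rewrite pE S_E; ring.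
rewrite -[l](subrK l2) addrC; apply: val_addr => //.
apply: vge_vgt hd.
have p0 : 0 < 2 ^+ n.-1 :> R by rewrite exprn_gt0.
have : 2 ^- n.-1 * S%:R < 1 :> R.
  rewrite mulrC ltr_pdivrMr // mul1r -natrX ltr_nat.
  by have := ltn_expl n.-1 (isT : 1 < 2)%N; lia.
lra.
Qed.

(** * Convergence of complex series *)
Local Open Scope complex_scope.
Local Open Scope classical_set_scope.

Lemma has_sumP (K : numFieldType) (u : nat -> K) (l : K) :
  has_sum u l <-> forall e : K, 0 < e -> exists n0, forall n, (n0 <= n)%N ->
    `|l - \sum_(k < n) u k| < e.
Proof.
rewrite /has_sum; split.
  move=> /cvgrPdist_lt h e e0; have [n0 _ hn] := h e e0.
  by exists n0 => n n0n; have := hn n n0n; rewrite /= /series /= big_mkord.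
move=> h; apply/cvgrPdist_lt => e e0; have [n0 hn] := h e e0.
by exists n0 => // n /= n0n; rewrite /series /= big_mkord; exact: hn.
Qed.

Lemma has_sum_uniq (K : numFieldType) (u : nat -> K) (l l' : K) :
  has_sum u l -> has_sum u l' -> l = l'.
Proof. by move=> h h'; apply: (cvg_unique _ h h'); exact: norm_hausdorff. Qed.

Lemma near_ballP (K : numFieldType) (z0 : K) (P : K -> Prop) :
  (\forall z \near z0, P z) <-> exists2 e : K, 0 < e & forall z, `|z0 - z| < e -> P z.
Proof.
split; first by move/nbhs_normP => [e e0 he]; exists e.
by move=> [e e0 he]; apply/nbhs_normP; exists e.
Qed.

Section Cabs.
Variable R : realType.
Implicit Types (z w : R[i]) (x y : R).

(** The absolute value as an element of R, the norm of R[i] being R[i]-valued. *)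
Definition cabs z : R := Num.sqrt (complex.Re z ^+ 2 + complex.Im z ^+ 2).

Lemma norm_cabs z : `|z| = (cabs z)%:C. Proof. exact: normc_def. Qed.
Lemma cabs_ge0 z : 0 <= cabs z. Proof. exact: sqrtr_ge0. Qed.

Lemma cabsD z w : cabs (z + w) <= cabs z + cabs w.
Proof. by rewrite -lecR rmorphD /= -!norm_cabs ler_normD. Qed.
Lemma cabsM z w : cabs (z * w) = cabs z * cabs w.
Proof. by apply: (@complexI R); rewrite rmorphM /= -!norm_cabs normrM. Qed.
Lemma cabsN z : cabs (- z) = cabs z.
Proof. by apply: (@complexI R); rewrite -!norm_cabs normrN. Qed.
Lemma cabs0 : cabs 0 = 0.
Proof. by apply: (@complexI R); rewrite -!norm_cabs normr0. Qed.
Lemma cabsX z n : cabs (z ^+ n) = cabs z ^+ n.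
Proof. by apply: (@complexI R); rewrite rmorphXn /= -!norm_cabs normrX. Qed.
Lemma cabs_eq0 z : (cabs z == 0) = (z == 0).
Proof. by rewrite -[RHS]normr_eq0 norm_cabs -(inj_eq (@complexI R)). Qed.
Lemma cabs_real x : cabs x%:C = `|x|.
Proof. by rewrite /cabs /= expr0n /= addr0 sqrtr_sqr. Qed.
Lemma cabs_Re z : `|complex.Re z| <= cabs z.
Proof. by rewrite -sqrtr_sqr ler_sqrt ?addr_ge0 ?sqr_ge0 // lerDl sqr_ge0. Qed.
Lemma cabs_Im z : `|complex.Im z| <= cabs z.
Proof. by rewrite -sqrtr_sqr ler_sqrt ?addr_ge0 ?sqr_ge0 // lerDr sqr_ge0. Qed.
Lemma cabs_le z : cabs z <= `|complex.Re z| + `|complex.Im z|.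
Proof.
have e : z = (complex.Re z)%:C + (0 +i* 1) * (complex.Im z)%:C.
  by case: z => a b; simpc.
rewrite {1}e; apply: le_trans (cabsD _ _) _; rewrite cabsM !cabs_real.
by rewrite [cabs (0 +i* 1)]/cabs /= expr0n expr1n add0r sqrtr1 mul1r.
Qed.
Lemma cabs_sum (I : Type) (r : seq I) (P : pred I) (f : I -> R[i]) :
  cabs (\sum_(i <- r | P i) f i) <= \sum_(i <- r | P i) cabs (f i).
Proof.
elim/big_ind2: _ => //; first by rewrite cabs0.
by move=> a x b y hx hy; apply: le_trans (cabsD _ _) _; exact: lerD.
Qed.

Lemma complex_ReD z w : complex.Re (z + w) = complex.Re z + complex.Re w. Proof. by case: z; case: w. Qed.
Lemma complex_ImD z w : complex.Im (z + w) = complex.Im z + complex.Im w. Proof. by case: z; case: w. Qed.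

Lemma complex_Re_sum (I : Type) (r : seq I) (P : pred I) (f : I -> R[i]) :
  complex.Re (\sum_(i <- r | P i) f i) = \sum_(i <- r | P i) complex.Re (f i).
Proof. by elim/big_ind2: _ => // a x b y <- <-; rewrite complex_ReD. Qed.
Lemma complex_Im_sum (I : Type) (r : seq I) (P : pred I) (f : I -> R[i]) :
  complex.Im (\sum_(i <- r | P i) f i) = \sum_(i <- r | P i) complex.Im (f i).
Proof. by elim/big_ind2: _ => // a x b y <- <-; rewrite complex_ImD. Qed.

Lemma has_csumP (u : nat -> R[i]) l :
  has_sum u l <-> forall e : R, 0 < e -> exists n0, forall n, (n0 <= n)%N ->
    cabs (l - \sum_(k < n) u k) < e.
Proof.
split=> [/has_sumP h e e0|h].
  have [|n0 hn] := h e%:C; first by rewrite ltcR.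
  by exists n0 => n /hn; rewrite norm_cabs ltcR.
apply/has_sumP => e e0.
have eE : e = (complex.Re e)%:C.
  by move: e0; case: e => a b; rewrite ltcE /= => /andP[/eqP ->].
have [|n0 hn] := h (complex.Re e); first by rewrite -ltcR -eE.
by exists n0 => n /hn; rewrite norm_cabs [in X in _ -> X]eE ltcR.
Qed.

Lemma analytic_atP (f : R[i] -> R[i]) z0 : analytic_at f z0 <->
  exists a : nat -> R[i], exists2 e : R, 0 < e &
    forall z, cabs (z - z0) < e -> has_sum (fun k => a k * (z - z0) ^+ k) (f z).
Proof.
split=> [[a /near_ballP[e e0 he]]|[a [e e0 he]]]; exists a.
  have eE : e = (complex.Re e)%:C.
    by move: e0; case: e {he} => x y; rewrite ltcE /= => /andP[/eqP ->].
  exists (complex.Re e); first by rewrite -ltcR -eE.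
  by move=> z hz; apply: he; rewrite -normrN opprB norm_cabs eE ltcR.
apply/near_ballP; exists e%:C; first by rewrite ltcR.
by move=> z; rewrite -normrN opprB norm_cabs ltcR; exact: he.
Qed.

Lemma has_sum_ext (u v : nat -> R[i]) l : u =1 v -> has_sum u l -> has_sum v l.
Proof. by move=> /funext ->. Qed.

Lemma has_sumD (u v : nat -> R[i]) l l' :
  has_sum u l -> has_sum v l' -> has_sum (fun k => u k + v k) (l + l').
Proof.
move=> /has_csumP h /has_csumP h'; apply/has_csumP => e e0.
have e2 : 0 < e / 2 by lra.
have [n0 hn] := h _ e2; have [n1 hn1] := h' _ e2.
exists (maxn n0 n1) => n; rewrite geq_max => /andP[/hn ? /hn1 ?].
rewrite big_split /= opprD addrACA; apply: le_lt_trans (cabsD _ _) _; lra.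
Qed.

Lemma has_sumZ (u : nat -> R[i]) l a : has_sum u l -> has_sum (fun k => a * u k) (a * l).
Proof.
move=> /has_csumP h; apply/has_csumP => e e0.
have a1 : 0 < cabs a + 1 by have := cabs_ge0 a; lra.
have [|n0 hn] := h (e / (cabs a + 1)); first by rewrite divr_gt0.
exists n0 => n /hn; rewrite ltr_pdivlMr // => h1.
rewrite -mulr_sumr -mulrBr cabsM; apply: le_lt_trans h1; rewrite mulrC.
by rewrite ler_wpM2l ?cabs_ge0 //; lra.
Qed.

Lemma has_sum0 : has_sum (fun=> 0 : R[i]) 0.
Proof.
apply/has_csumP => e e0; exists 0%N => n _.
by rewrite big1 // subrr cabs0.
Qed.

Lemma has_sum_sum (I : Type) (r : seq I) (u : I -> nat -> R[i]) (l : I -> R[i]) :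
  (forall i, has_sum (u i) (l i)) ->
  has_sum (fun k => \sum_(i <- r) u i k) (\sum_(i <- r) l i).
Proof.
move=> ul; elim: r => [|i r IH].
  by rewrite big_nil; apply: has_sum_ext has_sum0 => k; rewrite big_nil.
rewrite big_cons; apply: has_sum_ext (has_sumD (ul i) IH) => k.
by rewrite big_cons.
Qed.

Lemma has_sum_bound (u : nat -> R[i]) l C :
  has_sum u l -> (forall n, \sum_(k < n) cabs (u k) <= C) -> cabs l <= C.
Proof.
move=> /has_csumP h hC; rewrite leNgt; apply/negP => hl.
have [|n0 hn] := h (cabs l - C); first by rewrite subr_gt0.
have := hn n0 (leqnn _); rewrite ltNge => /negP; apply.
have e : cabs l <= cabs (l - \sum_(k < n0) u k) + cabs (\sum_(k < n0) u k).
  by rewrite -{1}[l](subrK (\sum_(k < n0) u k)) cabsD.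
by have := le_trans (cabs_sum _ _ (fun k : 'I_n0 => u k)) (hC n0); lra.
Qed.

Lemma real_sum_exists (u : nat -> R) C :
  (forall n, \sum_(k < n) `|u k| <= C) ->
  exists l, forall e : R, 0 < e -> exists n0, forall n, (n0 <= n)%N ->
    `|l - \sum_(k < n) u k| < e.
Proof.
move=> hC.
have cv : cvgn (series u).
  apply: normed_cvg; apply: nondecreasing_is_cvgn.
    by apply: nondecreasing_series => n _ _ /=.
  exists C => _ [n _ <-]; rewrite /= /series /= big_mkord.
  exact: hC.
exists (limn (series u)) => e e0.
have /cvgrPdist_lt/(_ e e0)[n0 _ hn] := cv.
by exists n0 => n /hn; rewrite /series /= big_mkord.
Qed.

(** Absolute convergence, from the completeness of R applied to real and
    imaginary parts. *)
Lemma has_sum_exists (u : nat -> R[i]) C :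
  (forall n, \sum_(k < n) cabs (u k) <= C) -> exists l, has_sum u l.
Proof.
move=> hC.
have [|a ha] := @real_sum_exists (fun k => complex.Re (u k)) C.
  by move=> n; apply: le_trans (hC n); apply: ler_sum => k _; exact: cabs_Re.
have [|b hb] := @real_sum_exists (fun k => complex.Im (u k)) C.
  by move=> n; apply: le_trans (hC n); apply: ler_sum => k _; exact: cabs_Im.
exists (a +i* b); apply/has_csumP => e e0.
have e2 : 0 < e / 2 by lra.
have [n0 hn0] := ha _ e2; have [n1 hn1] := hb _ e2.
exists (maxn n0 n1) => n; rewrite geq_max => /andP[/hn0 h0 /hn1 h1].
apply: le_lt_trans (cabs_le _) _.
rewrite complex_ReD complex_ImD /=.
have -> : complex.Re (- \sum_(k < n) u k) = - \sum_(k < n) complex.Re (u k).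
  by rewrite -complex_Re_sum; case: (\sum_(k < n) u k).
have -> : complex.Im (- \sum_(k < n) u k) = - \sum_(k < n) complex.Im (u k).
  by rewrite -complex_Im_sum; case: (\sum_(k < n) u k).
lra.
Qed.

Lemma has_sum_tail (u : nat -> R[i]) l J :
  has_sum u l -> has_sum (fun k => u (J + k)%N) (l - \sum_(k < J) u k).
Proof.
move=> /has_csumP h; apply/has_csumP => e /h[n0 hn].
exists n0 => n n0n; rewrite -addrA -opprD -(@big_split_ord _ _ _ J n xpredT (fun i => u i)) /=.
by apply: hn; rewrite (leq_trans n0n) // leq_addl.
Qed.
End Cabs.

(** * Power series *)

Section PowerSeries.
Variable R : realType.
Implicit Types (z w : R[i]).

Lemma sum_geometric_le (t : R) n : 0 <= t <= 1 / 2 -> \sum_(k < n) t ^+ k <= 2.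
Proof.
move=> /andP[t0 t1].
suff H : \sum_(k < n) t ^+ k <= 2 - 2 * t ^+ n.
  by apply: le_trans H _; rewrite gerBl mulr_ge0 // exprn_ge0.
elim: n => [|n IH]; first by rewrite big_ord0 expr0; lra.
rewrite big_ord_recr /= exprS.
have : 0 <= t ^+ n by exact: exprn_ge0.
nra.
Qed.

Lemma has_sum_geometric_tail (b : nat -> R[i]) s B t J :
  0 <= t <= 1 / 2 -> has_sum b s -> (forall j, cabs (b j) <= B * t ^+ j) ->
  cabs (s - \sum_(j < J) b j) <= 2 * B * t ^+ J.
Proof.
move=> t01 /(@has_sum_tail _ _ _ J) h hB; apply: (has_sum_bound h) => n.
have t0 : 0 <= t by case/andP: t01.
have B0 : 0 <= B by have := le_trans (cabs_ge0 _) (hB 0); rewrite expr0 mulr1.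
apply: (@le_trans _ _ (\sum_(k < n) B * t ^+ (J + k))).
  by apply: ler_sum => k _; exact: hB.
rewrite (eq_bigr (fun k : 'I_n => B * t ^+ J * t ^+ k)); last first.
  by move=> k _; rewrite exprD mulrA.
rewrite -mulr_sumr [X in _ <= X](_ : _ = B * t ^+ J * 2); last by ring.
by rewrite ler_wpM2l ?sum_geometric_le // mulr_ge0 // exprn_ge0.
Qed.

Lemma expr_half_small (C e : R) : 0 < e -> exists n0, forall n, (n0 <= n)%N ->
  C * (1 / 2) ^+ n < e.
Proof.
move=> e0; have [n0 hn0] : exists n0 : nat, C / e < n0%:R.
  by exists (Num.bound (`|C / e|)); apply: le_lt_trans (ler_norm _) (archi_boundP _).
exists n0 => n n0n.
have p2 : 0 < 2 ^+ n :> R by rewrite exprn_gt0.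
rewrite div1r exprVn ltr_pdivrMr // mulrC -ltr_pdivrMr //.
apply: lt_trans hn0 _; apply: (@le_lt_trans _ _ n%:R); first by rewrite ler_nat.
by rewrite -natrX ltr_nat ltn_expl.
Qed.

(** Weierstrass' theorem on uniform limits in terms of Taylor coefficients: if
    the k-th function has coefficients bounded by M_k / r^j, then at distance at most
    r / 2 its Taylor remainder of order J is at most 2 M_k / 2^J, and summing over k
    bounds the remainder of the sum. *)
Lemma has_sum_power_series (a : nat -> nat -> R[i]) (A f : nat -> R[i]) (F h : R[i])
    (M : nat -> R) (C r : R) : 0 < r ->
  (forall n, \sum_(k < n) M k <= C) -> (forall k j, cabs (a k j) * r ^+ j <= M k) ->
  cabs h <= r / 2 -> (forall j, has_sum (a^~ j) (A j)) ->
  (forall k, has_sum (fun j => a k j * h ^+ j) (f k)) -> has_sum f F ->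
  has_sum (fun j => A j * h ^+ j) F.
Proof.
move=> r0 MC aM hr aA af fF; apply/has_csumP => e e0.
have [n0 hn0] := expr_half_small (2 * C) e0.
exists n0 => J /hn0; apply: le_lt_trans.
have hf : has_sum (fun k => f k - \sum_(j < J) a k j * h ^+ j) (F - \sum_(j < J) A j * h ^+ j).
  have -> : F - \sum_(j < J) A j * h ^+ j = F + -1 * \sum_(j < J) h ^+ j * A j.
    by rewrite mulN1r; congr (_ - _); apply: eq_bigr => j _; rewrite mulrC.
  have h1 (j : 'I_J) := has_sumZ (a := h ^+ j) (aA j).
  have h2 := has_sum_sum (r := index_enum 'I_J) h1.
  have h3 := has_sumD fF (has_sumZ (a := -1) h2).
  apply: has_sum_ext h3 => k /=.
  by rewrite mulN1r; congr (_ - _); apply: eq_bigr => j _; rewrite mulrC.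
apply: (has_sum_bound hf) => n.
apply: (@le_trans _ _ (\sum_(k < n) 2 * (1 / 2) ^+ J * M k)); last first.
  rewrite -mulr_sumr [X in _ <= X](_ : _ = 2 * (1 / 2) ^+ J * C); last by ring.
  by rewrite ler_wpM2l // mulr_ge0 // exprn_ge0 //; lra.
apply: ler_sum => k _.
rewrite [X in _ <= X](_ : _ = 2 * M k * (1 / 2) ^+ J); last by ring.
apply: has_sum_geometric_tail (af k) _; first by lra.
move=> j; rewrite cabsM cabsX; apply: le_trans (_ : cabs (a k j) * (r / 2) ^+ j <= _).
  by rewrite ler_wpM2l ?cabs_ge0 // lerXn2r ?nnegrE ?cabs_ge0 //; lra.
by rewrite div1r exprMn mulrA ler_wpM2r // exprn_ge0 // invr_ge0.
Qed.

Lemma has_sum_bounded (u : nat -> R[i]) l : has_sum u l -> exists B, forall k, cabs (u k) <= B.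
Proof.
move=> /has_csumP/(_ 1 ltr01)[n0 hn]; exists (2 + \sum_(k < n0) cabs (u k)) => k.
have S0 : 0 <= \sum_(k < n0) cabs (u k) by apply: sumr_ge0 => i _; exact: cabs_ge0.
case: (leqP n0 k) => kn.
  have h1 := hn k kn; have := hn k.+1 (leqW kn); rewrite big_ord_recr /= => h2.
  have : cabs (u k) <= cabs (l - \sum_(i < k) u i) + cabs (l - (\sum_(i < k) u i + u k)).
    have {1}-> : u k = (l - \sum_(i < k) u i) + - (l - (\sum_(i < k) u i + u k)) by ring.
    by apply: le_trans (cabsD _ _) _; rewrite cabsN.
  lra.
rewrite (bigD1 (Ordinal kn)) //= in S0 *.
have : 0 <= \sum_(i < n0 | i != Ordinal kn) cabs (u i).
  by apply: sumr_ge0 => i _; exact: cabs_ge0.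
lra.
Qed.

(** If k is the first index with a_k <> 0, then a zero h gives
    |a_k| |h|^k <= D |h|^(k+1), impossible for small h. *)
Lemma power_series_zero (a : nat -> R[i]) (f : R[i] -> R[i]) e : 0 < e ->
  (forall h, cabs h < e -> has_sum (fun k => a k * h ^+ k) (f h)) ->
  (forall d, 0 < d -> exists h, [/\ h != 0, cabs h < d & f h = 0]) ->
  forall k, a k = 0.
Proof.
move=> e0 af hz.
have [B hB] : exists B, forall k, cabs (a k) * (e / 2) ^+ k <= B.
  have [|B hB] := has_sum_bounded (af (e / 2)%:C _).
    by rewrite cabs_real ger0_norm; lra.
  exists B => k; have := hB k; rewrite cabsM cabsX cabs_real ger0_norm //; lra.
have B0 : 0 <= B.
  by apply: le_trans (hB 0); rewrite expr0 mulr1 cabs_ge0.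
elim/ltn_ind => k IH; apply/eqP; rewrite -cabs_eq0 eq_le cabs_ge0 andbT.
rewrite leNgt; apply/negP => ak.
(* D |h|^(k+1) bounds the terms of index greater than k, if |h| <= e / 4. *)
pose D := 2 * B * (2 / e) ^+ k.+1.
have D0 : 0 <= D by rewrite !mulr_ge0 // exprn_ge0 // divr_ge0 // ltW.
have [|h [h0 hd fh]] := hz (Num.min (e / 4) (cabs (a k) / (D + 1))).
  by rewrite lt_min divr_gt0 //= divr_gt0 //; lra.
move: hd; rewrite lt_min => /andP[hd1 hd2].
have he : cabs h < e by lra.
have hc0 : 0 < cabs h by rewrite lt_def cabs_eq0 h0 cabs_ge0.
pose t := cabs h * (2 / e).
have t01 : 0 <= t <= 1 / 2.
  apply/andP; split; first by rewrite mulr_ge0 ?cabs_ge0 // divr_ge0 // ltW.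
  by rewrite /t mulrA ler_pdivrMr //; lra.
have := @has_sum_geometric_tail _ _ B t k.+1 t01 (af h he).
rewrite fh sub0r cabsN big_ord_recr /= big1 ?add0r; last first.
  by move=> i _; rewrite IH ?mul0r.
have -> : 2 * B * t ^+ k.+1 = D * cabs h * cabs h ^+ k.
  by rewrite /D /t exprMn [cabs h ^+ k.+1]exprS; ring.
rewrite cabsM cabsX ler_pM2r ?exprn_gt0 // => H.
have : cabs (a k) <= D * cabs h.
  apply: H => j; rewrite cabsM cabsX.
  have -> : cabs (a j) * cabs h ^+ j = (cabs (a j) * (e / 2) ^+ j) * t ^+ j.
    rewrite /t -mulrA -exprMn; congr (_ * _ ^+ _); field; lra.
  by rewrite ler_wpM2r // exprn_ge0 //; case/andP: t01.
move: hd2; rewrite ltr_pdivlMr; last by lra.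
nra.
Qed.

(** The parameters t around whose image f vanishes identically form an open
    set, closed because zeros of a nonzero power series are isolated; R is
    connected. *)
Lemma identity_line (f : R[i] -> R[i]) (p q : R[i]) e : q != 0 ->
  (forall t : R, analytic_at f (p + t%:C * q)) ->
  0 < e -> (forall z, cabs (z - p) < e -> f z = 0) ->
  forall t : R, f (p + t%:C * q) = 0.
Proof.
move=> q0 fan e0 fz.
have qc : 0 < cabs q by rewrite lt_def cabs_eq0 q0 cabs_ge0.
pose g (t : R) := p + t%:C * q.
have gB t t' : cabs (g t' - g t) = `|t' - t| * cabs q.
  by rewrite /g -cabs_real -cabsM; congr cabs; rewrite rmorphB /=; ring.
pose B := [set t : R | exists2 d : R, 0 < d & forall z, cabs (z - g t) < d -> f z = 0].
suff BT : B = setT.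
  move=> t; have : B t by rewrite BT.
  by case=> d d0; apply; rewrite /g subrr cabs0.
have conn : connected [set: R] by apply/connected_intervalP.
have Bopen : open B.
  rewrite openE => t [d d0 hd]; rewrite /interior /=.
  apply/nbhs_ballP; exists (d / 2 / cabs q) => /=; first by rewrite !divr_gt0.
  move=> t' /=; rewrite /ball /= ltr_pdivlMr // => tt'.
  exists (d / 2); first by rewrite divr_gt0.
  move=> z hz; apply: hd.
  have -> : z - g t = (z - g t') + (g t' - g t) by ring.
  apply: le_lt_trans (cabsD _ _) _; rewrite gB distrC; lra.
have Bclosed : closed B.
  move=> t clt.
  have [Bt|nBt] := pselect (B t); first by [].
  have /analytic_atP[a [d d0 ha]] := fan t.
  have a0 : forall k, a k = 0.
    apply: (@power_series_zero a (fun h => f (g t + h)) d d0).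
      move=> h hd; have := ha (g t + h); rewrite addrC addKr; exact.
    move=> d' d'0.
    have /clt[t' [Bt' /= tt']] : nbhs t (ball t (d' / cabs q)).
      by apply: nbhsx_ballx; rewrite divr_gt0.
    move: tt'; rewrite /ball /= ltr_pdivlMr // => tt'.
    exists (g t' - g t); split.
    - rewrite -cabs_eq0 gB mulf_eq0 negb_or (gt_eqF qc) andbT normr_eq0 subr_eq0.
      by apply/eqP => e1; apply: nBt; rewrite -e1.
    - by rewrite gB distrC.
    - by rewrite addrC subrK; case: Bt' => d'' d''0; apply; rewrite subrr cabs0.
  exists d => // z /ha hs; apply: has_sum_uniq hs _.
  apply: has_sum_ext (@has_sum0 R) => k.
  by rewrite a0 mul0r.
apply: conn.
- exists 0; exists e => // z; rewrite /g /= mul0r addr0; exact: fz.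
- by exists B => //; rewrite setTI.
- by exists B => //; rewrite setTI.
Qed.
End PowerSeries.

(** * The complex exponential series *)

Section ComplexExp.
Variable R : realType.
Implicit Types (z w s : R[i]) (x y t : R).

Lemma complex_ReM z w :
  complex.Re (z * w) = complex.Re z * complex.Re w - complex.Im z * complex.Im w.
Proof. by case: z; case: w. Qed.
Lemma complex_ImM z w :
  complex.Im (z * w) = complex.Re z * complex.Im w + complex.Im z * complex.Re w.
Proof. by case: z; case: w. Qed.

Lemma cexpD z w : cexp (z + w) = cexp z * cexp w.
Proof.
case: z => a b; case: w => c d; rewrite /cexp /= expRD cosD sinD; simpc.
by apply/eqP; rewrite eq_complex /=; apply/andP; split; apply/eqP; ring.
Qed.

Lemma cexp0 : cexp 0 = 1 :> R[i].
Proof. by rewrite /cexp /= expR0 cos0 sin0; simpc. Qed.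

Lemma cabs_cexp z : cabs (cexp z) = expR (complex.Re z).
Proof.
rewrite /cexp cabsM cabs_real ger0_norm ?expR_ge0 // /cabs /= cos2Dsin2 sqrtr1.
by rewrite mulr1.
Qed.

(** The derivative of a complex-valued function of a real variable, taken on
    real and imaginary parts so that the real mean value theorem applies. *)
Definition is_cderive (F : R -> R[i]) (x : R) (D : R[i]) : Prop :=
  is_derive x 1 (fun y => complex.Re (F y)) (complex.Re D) /\
  is_derive x 1 (fun y => complex.Im (F y)) (complex.Im D).

Lemma is_cderive_ext F G x D D' : F =1 G -> D = D' -> is_cderive F x D -> is_cderive G x D'.
Proof. by move=> /funext -> ->. Qed.

Lemma is_cderiveD F G x D E : is_cderive F x D -> is_cderive G x E ->
  is_cderive (fun y => F y + G y) x (D + E).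
Proof.
move=> [F1 F2] [G1 G2]; split.
  rewrite complex_ReD (_ : (fun y => _) = (fun y => complex.Re (F y)) + (fun y => complex.Re (G y))).
    exact: is_deriveD.
  by apply/funext => y; rewrite complex_ReD.
rewrite complex_ImD (_ : (fun y => _) = (fun y => complex.Im (F y)) + (fun y => complex.Im (G y))).
  exact: is_deriveD.
by apply/funext => y; rewrite complex_ImD.
Qed.

Lemma is_cderiveZ F x D a : is_cderive F x D -> is_cderive (fun y => a * F y) x (a * D).
Proof.
move=> [F1 F2]; case: a => b c; split.
  rewrite (_ : (fun y => _) = b \*: (fun y => complex.Re (F y)) - c \*: (fun y => complex.Im (F y))).
    have := is_deriveB (is_deriveZ b F1) (is_deriveZ c F2).
    by case: D {F1 F2}.
  by apply/funext => y; rewrite complex_ReM.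
rewrite (_ : (fun y => _) = b \*: (fun y => complex.Im (F y)) + c \*: (fun y => complex.Re (F y))).
  have := is_deriveD (is_deriveZ b F2) (is_deriveZ c F1).
  by case: D {F1 F2}.
by apply/funext => y; rewrite complex_ImM.
Qed.

Lemma is_cderive_cst a x : is_cderive (fun=> a) x 0.
Proof. by split; exact: is_derive_cst. Qed.

Lemma is_cderive_shift F x D c : is_cderive F (x + c) D -> is_cderive (fun y => F (y + c)) x D.
Proof.
have dc : is_derive x 1 (fun y : R => y + c) 1.
  by have := is_deriveD (is_derive_id x 1) (is_derive_cst c x 1); rewrite addr0.
move=> [F1 F2]; split.
  by have := is_derive1_comp (f := fun y => complex.Re (F y)) (g := fun y => y + c) F1 dc; rewrite mulr1.
by have := is_derive1_comp (f := fun y => complex.Im (F y)) (g := fun y => y + c) F2 dc; rewrite mulr1.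
Qed.

Lemma is_cderive_cexp w (u : R -> R) x du : is_derive x 1 u du ->
  is_cderive (fun y => cexp (w * (u y)%:C)) x (w * du%:C * cexp (w * (u x)%:C)).
Proof.
case: w => a b hu.
have ha : is_derive x 1 (fun y => a * u y) (a * du) by exact: is_deriveZ.
have hb : is_derive x 1 (fun y => b * u y) (b * du) by exact: is_deriveZ.
have he := is_derive1_comp (f := expR) (g := fun y => a * u y) (is_derive_expR _) ha.
have hc := is_derive1_comp (f := cos) (g := fun y => b * u y) (is_derive_cos _) hb.
have hs := is_derive1_comp (f := sin) (g := fun y => b * u y) (is_derive_sin _) hb.
have reE : (fun y => complex.Re (cexp ((a +i* b) * (u y)%:C))) =
    (expR \o (fun y => a * u y)) * (cos \o (fun y => b * u y)).
  by apply/funext => y; rewrite /cexp; simpc.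
have imE : (fun y => complex.Im (cexp ((a +i* b) * (u y)%:C))) =
    (expR \o (fun y => a * u y)) * (sin \o (fun y => b * u y)).
  by apply/funext => y; rewrite /cexp; simpc.
split.
  rewrite reE; apply: is_derive_eq (is_deriveM he hc) _.
  rewrite /cexp; simpc => /=; rewrite /GRing.scale /=; ring.
rewrite imE; apply: is_derive_eq (is_deriveM he hs) _.
by rewrite /cexp; simpc => /=; rewrite /GRing.scale /=; ring.
Qed.

Lemma mean_value (f df : R -> R) (a b : R) : a < b ->
  (forall y, a <= y -> y <= b -> is_derive y 1 f (df y)) ->
  exists c, [/\ a < c, c < b & f b - f a = df c * (b - a)].
Proof.
move=> ab fd; have [||c] := @MVT R f df a b ab.
- by move=> x; rewrite in_itv /= => /andP[/ltW ax /ltW xb]; exact: fd.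
- apply: derivable_within_continuous => x; rewrite in_itv /= => /andP[ax xb].
  by have [] := fd x ax xb.
by rewrite in_itv /= => /andP[ac cb] e; exists c.
Qed.

(** The functions D y^(J+1) / (J+1)! - f and D y^(J+1) / (J+1)! + f have
    nonnegative derivative. *)
Lemma real_deriv_bound (f df : R -> R) (D : R) J t : 0 <= t -> f 0 = 0 ->
  (forall y, is_derive y 1 f (df y)) ->
  (forall y, 0 <= y -> y <= t -> `|df y| <= D * y ^+ J / J`!%:R) ->
  `|f t| <= D * t ^+ J.+1 / J.+1`!%:R.
Proof.
move=> t0 f0 fd bd.
have [<-|t00] := eqVneq 0 t; first by rewrite f0 normr0 expr0n /= mulr0 mul0r.
have tp : 0 < t by rewrite lt_def eq_sym t00.
pose g y := D * y ^+ J.+1 / J.+1`!%:R.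
have gd y : is_derive y 1 g (D * y ^+ J / J`!%:R).
  have h := is_deriveZ (D / J.+1`!%:R) (is_deriveX J.+1 (is_derive_id y 1)).
  rewrite (_ : g = (D / J.+1`!%:R) \*: id ^+ J.+1); last first.
    by apply/funext => x; rewrite /g mulrAC !fctE.
  apply: is_derive_eq h _; rewrite /GRing.scale /= mulr1 factS natrM.
  by field; rewrite !pnatr_eq0 -!lt0n fact_gt0 /=.
have g0 : g 0 = 0 by rewrite /g expr0n /= mulr0 mul0r.
have H (sg : bool) : (-1) ^+ sg * f t <= g t.
  have der y : 0 <= y -> y <= t -> is_derive y 1 (fun y => g y - (-1) ^+ sg * f y)
      (D * y ^+ J / J`!%:R - (-1) ^+ sg * df y).
    by move=> _ _; apply: is_deriveB; exact: is_deriveZ.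
  have [c [c0 ct]] := mean_value tp der.
  rewrite f0 g0 mulr0 !subr0 => e; rewrite -subr_ge0 e mulr_ge0 // subr_ge0.
  apply: le_trans (bd c (ltW c0) (ltW ct)); apply: le_trans (ler_norm _) _.
  by rewrite normrM normrX normrN1 expr1n mul1r.
by rewrite ler_norml -/(g t) lerNl; apply/andP; split;
  [have := H true; rewrite mulN1r|have := H false; rewrite mul1r].
Qed.

Lemma fact_dominates (c e : R) : 0 < e -> 0 <= c -> exists n0, forall n, (n0 <= n)%N ->
  c ^+ n / n`!%:R < e.
Proof.
move=> e0 c0.
have /cvg_series_cvg_0 := @is_cvg_series_exp_coeff R c.
move=> /cvgrPdist_lt/(_ e e0)[n0 _ hn]; exists n0 => n /hn /=.
rewrite sub0r normrN /exp_coeff ger0_norm // divr_ge0 // exprn_ge0 //.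
Qed.

Lemma is_cderive_sum n (F : nat -> R -> R[i]) x (D : nat -> R[i]) :
  (forall k, is_cderive (F k) x (D k)) ->
  is_cderive (fun y => \sum_(k < n) F k y) x (\sum_(k < n) D k).
Proof.
move=> FD; elim: n => [|n IH].
  by apply: is_cderive_ext (is_cderive_cst 0 x) => [y|]; rewrite big_ord0.
by apply: is_cderive_ext (is_cderiveD IH (FD n)) => [y|]; rewrite big_ord_recr.
Qed.

Lemma is_cderive_real (u : R -> R) (du : R) x : is_derive x 1 u du ->
  is_cderive (fun y => (u y)%:C) x du%:C.
Proof. by move=> h; split=> //=; exact: is_derive_cst. Qed.

Lemma is_cderive_exp_term w j y :
  is_cderive (fun y => (j.+1`!%:R^-1)%:C * (w * y%:C) ^+ j.+1) y
    (w * ((j`!%:R^-1)%:C * (w * y%:C) ^+ j)).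
Proof.
have h := is_deriveX j.+1 (is_derive_id y 1).
have := is_cderive_real h => /(is_cderiveZ ((j.+1`!%:R^-1)%:C * w ^+ j.+1)).
apply: is_cderive_ext => [x|].
  by rewrite exprMn -mulrA !fctE rmorphXn.
rewrite /GRing.scale /= mulr1 factS natrM exprMn exprS invfM !rmorphM /= rmorphXn /=.
rewrite fmorphV; field.
by rewrite [1 + _]addrC natr1 !pnatr_eq0 -!lt0n fact_gt0.
Qed.

(** The remainder of order J + 1 vanishes at 0 and its derivative is w times
    the remainder of order J. The factor 2^J is the price of estimating real and
    imaginary parts separately; the factorial absorbs it. *)
Lemma cexp_remainder w J t : 0 <= t -> t <= 1 ->
  cabs (cexp (w * t%:C) - \sum_(j < J) (j`!%:R^-1)%:C * (w * t%:C) ^+ j) <=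
  expR `|complex.Re w| * (2 * cabs w) ^+ J * t ^+ J / J`!%:R.
Proof.
pose h J t := cexp (w * t%:C) - \sum_(j < J) (j`!%:R^-1)%:C * (w * t%:C) ^+ j.
have hd K y : is_cderive (h K.+1) y (w * h K y).
  have h1 := is_cderive_cexp w (is_derive_id y 1).
  have h2 := is_cderive_sum K (fun j => is_cderive_exp_term w j y).
  have h3 := is_cderiveD (is_cderive_cst (- 1) y) (is_cderiveZ (-1) h2).
  apply: is_cderive_ext (is_cderiveD h1 h3) => [x|].
    rewrite /h big_ord_recl /= expr0 fact0 invr1 mulr1 opprD mulN1r.
    by congr (_ + (_ - _)).
  by rewrite /h mulr1 add0r mulN1r mulrBr mulr_sumr.
elim: J t => [|J IH] t t0 t1.
  rewrite big_ord0 subr0 cabs_cexp expr0 expr0 !mulr1 fact0 divr1 ler_expR.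
  rewrite complex_ReM /= mulr0 subr0; apply: le_trans (ler_norm _) _.
  by rewrite normrM (ger0_norm t0) ler_piMr.
have h0 : h J.+1 0 = 0.
  rewrite /h mulr0 cexp0 big_ord_recl /= expr0 fact0 invr1 mulr1 big1 ?addr0 ?subrr //.
  by move=> i _; rewrite exprS mul0r mulr0.
pose D := expR `|complex.Re w| * (2 * cabs w) ^+ J * cabs w.
have bd y : 0 <= y -> y <= t -> cabs (w * h J y) <= D * y ^+ J / J`!%:R.
  move=> y0 yt; rewrite cabsM mulrC /D.
  have := IH y y0 (le_trans yt t1); rewrite -/(h J y) => /(ler_wpM2r (cabs_ge0 w)).
  by move/le_trans; apply; rewrite le_eqVlt; apply/orP; left; apply/eqP; ring.
have hr := @real_deriv_bound (fun y => complex.Re (h J.+1 y)) (fun y => complex.Re (w * h J y))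
  D J t t0 (congr1 (@complex.Re R) h0) (fun y => (hd J y).1)
  (fun y hy ht => le_trans (cabs_Re _) (bd _ hy ht)).
have hi := @real_deriv_bound (fun y => complex.Im (h J.+1 y)) (fun y => complex.Im (w * h J y))
  D J t t0 (congr1 (@complex.Im R) h0) (fun y => (hd J y).2)
  (fun y hy ht => le_trans (cabs_Im _) (bd _ hy ht)).
apply: le_trans (cabs_le _) _; apply: le_trans (lerD hr hi) _.
by rewrite /D le_eqVlt; apply/orP; left; apply/eqP; rewrite [(2 * _) ^+ J.+1]exprS; ring.
Qed.

Lemma has_sum_cexp w : has_sum (fun j => (j`!%:R^-1)%:C * w ^+ j) (cexp w).
Proof.
apply/has_csumP => e e0.
pose B := expR `|complex.Re w|.
have B0 : 0 < B by exact: expR_gt0.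
have c0 : 0 <= 2 * cabs w by rewrite mulr_ge0 // cabs_ge0.
have [|n0 hn] := @fact_dominates (2 * cabs w) (e / B) _ c0; first by rewrite divr_gt0.
exists n0 => n /hn; rewrite ltr_pdivlMr // => h1.
have := @cexp_remainder w n 1 ler01 (lexx _); rewrite mulr1 expr1n mulr1 => h2.
by apply: le_lt_trans h2 _; rewrite -/B -mulrA mulrC.
Qed.
End ComplexExp.

(** * Iterated differences of powers *)

Section PowerKernel.
Variable R : realType.
Implicit Types (z w s : R[i]) (x t : R).

(** (- ln x)^j x^(-s) / j!, the j-th Taylor coefficient at s of z |-> x^(-z). *)
Definition powlog s j x : R[i] :=
  (j`!%:R^-1 * (- ln x) ^+ j)%:C * cexp (- s * (ln x)%:C).

Definition step_diff (F : R -> R[i]) x : R[i] := F x - F (x + 1).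

Lemma powlog0 s x : powlog s 0 x = cexp (- s * (ln x)%:C).
Proof. by rewrite /powlog fact0 invr1 expr0 mul1r mul1r. Qed.

Lemma cexp_ln_succ s x : 0 < x ->
  (x^-1)%:C * cexp (- s * (ln x)%:C) = cexp (- (s + 1) * (ln x)%:C).
Proof.
move=> x0; rewrite opprD mulrDl mulN1r cexpD mulrC; congr (_ * _).
rewrite -rmorphN /cexp /= cos0 sin0 expRN lnK ?posrE //; simpc.
by [].
Qed.

Lemma is_cderiveM_real (u : R -> R) (du : R) (F : R -> R[i]) D x :
  is_derive x 1 u du -> is_cderive F x D ->
  is_cderive (fun y => (u y)%:C * F y) x (du%:C * F x + (u x)%:C * D).
Proof.
move=> hu [F1 F2]; split.
  rewrite (_ : (fun y => _) = u * (fun y => complex.Re (F y))).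
    apply: is_derive_eq (is_deriveM hu F1) _.
    by rewrite complex_ReD !complex_ReM /= !mul0r !subr0 /GRing.scale /=; ring.
  by apply/funext => y; rewrite complex_ReM /= mul0r subr0.
rewrite (_ : (fun y => _) = u * (fun y => complex.Im (F y))).
  apply: is_derive_eq (is_deriveM hu F2) _.
  by rewrite complex_ImD !complex_ImM /= !mul0r !addr0 /GRing.scale /=; ring.
by apply/funext => y; rewrite complex_ImM /= mul0r addr0.
Qed.

Definition powlog_deriv s j x : R[i] :=
  - s * powlog (s + 1) j x - (if j is i.+1 then powlog (s + 1) i x else 0).

Lemma is_cderive_powlog s j x : 0 < x -> is_cderive (powlog s j) x (powlog_deriv s j x).
Proof.
move=> x0; have hl := is_derive1_ln x0.
have h1 := is_cderive_cexp (- s) hl.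
have h2 : is_derive x 1 (fun y => j`!%:R^-1 * (- ln y) ^+ j)
    (if j is i.+1 then - (i`!%:R^-1 * (- ln x) ^+ i * x^-1) else 0).
  case: j => [|j].
    rewrite (_ : (fun y => _) = cst 1); first exact: is_derive_cst.
    by apply/funext => y; rewrite fact0 invr1 expr0 mulr1.
  have h := is_deriveZ (j.+1`!%:R^-1 : R) (is_deriveX j.+1 (is_deriveN hl)).
  rewrite (_ : (fun y => _) = j.+1`!%:R^-1 \*: (- @ln R) ^+ j.+1); last first.
    by apply/funext => y; rewrite !fctE.
  apply: is_derive_eq h _; rewrite /GRing.scale /= factS natrM !fctE.
  by field; rewrite addrC natr1 !pnatr_eq0 -!lt0n fact_gt0 /= gt_eqF.
apply: is_cderive_ext (is_cderiveM_real h2 h1) => //.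
rewrite /powlog_deriv /powlog -!cexp_ln_succ //.
case: j {h2} => [|j]; rewrite ?rmorphN ?rmorphM /= ?rmorph0; ring.
Qed.

Lemma is_cderive_iter_step F F' r : (forall x, 0 < x -> is_cderive F x (F' x)) ->
  forall x, 0 < x -> is_cderive (iter r step_diff F) x (iter r step_diff F' x).
Proof.
move=> FD; elim: r => //= r IH x x0.
have x1 : 0 < x + 1 by rewrite addr_gt0.
have := is_cderiveD (IH x x0) (is_cderiveZ (-1) (is_cderive_shift (IH _ x1))).
by apply: is_cderive_ext => [y|]; rewrite /step_diff mulN1r.
Qed.

Lemma cabs_step_diff F F' x (B : R) : (forall y, x <= y -> is_cderive F y (F' y)) ->
  (forall y, x <= y -> cabs (F' y) <= B) -> cabs (step_diff F x) <= 2 * B.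
Proof.
move=> FD FB; have xx : x < x + 1 by rewrite ltrDl.
have [c [c1 _ hc]] := @mean_value _ (fun y => complex.Re (F y)) (fun y => complex.Re (F' y)) _ _
  xx (fun y hy _ => (FD y hy).1).
have [c' [c1' _ hc']] := @mean_value _ (fun y => complex.Im (F y)) (fun y => complex.Im (F' y)) _ _
  xx (fun y hy _ => (FD y hy).2).
move: hc hc'; rewrite [x + 1 - x]addrC addKr !mulr1 => hc hc'.
rewrite /step_diff -cabsN opprB; apply: le_trans (cabs_le _) _.
have -> : complex.Re (F (x + 1) - F x) = complex.Re (F (x + 1)) - complex.Re (F x).
  by case: (F (x + 1)); case: (F x).
have -> : complex.Im (F (x + 1) - F x) = complex.Im (F (x + 1)) - complex.Im (F x).
  by case: (F (x + 1)); case: (F x).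
rewrite hc hc'.
have := le_trans (cabs_Re _) (FB c (ltW c1)); have := le_trans (cabs_Im _) (FB c' (ltW c1')).
lra.
Qed.

Lemma iter_step_diffD F G a r x :
  iter r step_diff (fun y => a * F y - G y) x = a * iter r step_diff F x - iter r step_diff G x.
Proof. by elim: r x => //= r IH x; rewrite /step_diff !IH; ring. Qed.

Lemma iter_step_diff0 r x : iter r step_diff (fun=> 0) x = 0.
Proof. by elim: r x => //= r IH x; rewrite /step_diff !IH subrr. Qed.

(** Each difference costs a derivative, which turns x^(-s) into
    - s x^(-s-1) and lowers the power of the logarithm by one, at the price
    of a factor rho. *)
Fixpoint decay_const (rho : R) r s : R :=
  if r is r'.+1 then 2 * (cabs s + rho) * decay_const rho r' (s + 1) else 1.

Lemma decay_const_ge0 rho r s : 0 <= rho -> 0 <= decay_const rho r s.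
Proof.
move=> rho0; elim: r s => [|r IH] s /=; first exact: ler01.
by rewrite !mulr_ge0 // addr_ge0 // cabs_ge0.
Qed.

(** The r-th difference behaves like the r-th derivative. Keeping the weight
    rho^j makes the bound uniform in j, at the expense of x^rho, since
    (rho ln x)^j / j! <= x^rho. In the induction s increases as r decreases, so the
    exponent rho - Re s - r of x is constant; it has to be nonpositive because the
    mean value theorem evaluates at a point beyond x. *)
Lemma iter_powlog_decay rho r s j x : 0 <= rho -> 1 <= x ->
  rho - complex.Re s - r%:R <= 0 ->
  cabs (iter r step_diff (powlog s j) x) * rho ^+ j <=
  decay_const rho r s * expR ((rho - complex.Re s - r%:R) * ln x).
Proof.
move=> rho0; elim: r s j x => [|r IH] s j x x1 he.
  rewrite /= mul1r subr0 /powlog cabsM cabs_real cabs_cexp.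
  have l0 : 0 <= ln x by exact: ln_ge0.
  have -> : complex.Re (- s * (ln x)%:C) = - complex.Re s * ln x.
    by case: (s) => a b; rewrite complex_ReM /= mulr0 subr0.
  rewrite mulrBl expRD -mulNr mulrAC ler_wpM2r ?expR_ge0 //.
  rewrite normrM normrX normrN (ger0_norm l0) ger0_norm ?invr_ge0 //.
  rewrite -mulrA -exprMn mulrC [ln x * _]mulrC.
  have h0 : 0 <= rho * ln x by exact: mulr_ge0.
  case: j => [|j]; first by rewrite expr0 fact0 invr1 mul1r -expR0 ler_expR.
  apply: le_trans (expR_ge1Dxn j h0); lra.
have x0 : 0 < x by lra.
set e := rho - complex.Re s - r.+1%:R in he *.
have eE : rho - complex.Re (s + 1) - r%:R = e by rewrite /e complex_ReD /= -natr1; ring.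
have e0 : rho - complex.Re (s + 1) - r%:R <= 0 by rewrite eE.
clearbody e; set C := decay_const rho r (s + 1).
have C0 : 0 <= C by exact: decay_const_ge0.
have B0 : 0 < rho ^+ j \/ rho ^+ j = 0.
  by have := exprn_ge0 j rho0; rewrite le_eqVlt => /orP[/eqP <-|]; [right|left].
case: B0 => [B0|->]; last first.
  by rewrite mulr0 mulr_ge0 ?expR_ge0 // decay_const_ge0.
have bd y : x <= y -> cabs (iter r step_diff (powlog_deriv s j) y) <=
    (cabs s + rho) * C * expR (e * ln x) / rho ^+ j.
  move=> xy; have y1 : 1 <= y by lra.
  have ly : expR (e * ln y) <= expR (e * ln x).
    by rewrite ler_expR; apply: ler_wnM2l => //; rewrite ler_ln ?posrE //; lra.
  rewrite ler_pdivlMr // /powlog_deriv iter_step_diffD.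
  apply: (@le_trans _ _ ((cabs s + rho) * (C * expR (e * ln y)))); last first.
    by rewrite -!mulrA ler_wpM2l ?addr_ge0 ?cabs_ge0 // ler_wpM2l.
  apply: le_trans (ler_wpM2r (ltW B0) (cabsD _ _)) _.
  rewrite cabsM !cabsN !mulrDl; apply: lerD.
    by rewrite -mulrA ler_wpM2l ?cabs_ge0 // -eE; exact: IH.
  case: j B0 => [|j] _.
    by rewrite iter_step_diff0 cabs0 mul0r !mulr_ge0 // expR_ge0.
  rewrite exprS mulrCA ler_wpM2l // -eE; exact: IH.
have := @cabs_step_diff (iter r step_diff (powlog s j)) (iter r step_diff (powlog_deriv s j)) x _
  (fun y xy => is_cderive_iter_step r (@is_cderive_powlog s j) (lt_le_trans x0 xy)) bd.
rewrite -(ler_pM2r B0) => /le_trans; apply.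
rewrite mulrA divfK ?gt_eqF // -/C le_eqVlt; apply/orP; left; apply/eqP.
by rewrite /= -/C; ring.
Qed.

Lemma has_sum_powlog s h x : has_sum (fun j => powlog s j x * h ^+ j) (powlog (s + h) 0 x).
Proof.
rewrite powlog0 opprD mulrDl cexpD mulrC.
have := has_sumZ (a := cexp (- s * (ln x)%:C)) (@has_sum_cexp R (- h * (ln x)%:C)).
rewrite mulrC; apply: has_sum_ext => j.
have -> : - h * (ln x)%:C = h * (- ln x)%:C by rewrite rmorphN mulrN mulNr.
rewrite exprMn /powlog rmorphM rmorphXn /=; ring.
Qed.

Lemma has_sum_iter_powlog s h r x :
  has_sum (fun j => iter r step_diff (powlog s j) x * h ^+ j)
    (iter r step_diff (powlog (s + h) 0) x).
Proof.
elim: r x => [|r IH] x /=; first exact: has_sum_powlog.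
have := has_sumD (IH x) (has_sumZ (a := -1) (IH (x + 1))).
rewrite mulN1r; apply: has_sum_ext => j; rewrite /step_diff; ring.
Qed.
End PowerKernel.

(** * Analytic continuation of the Dirichlet series *)

Section Continuation.
Variable R : realType.
Variables (N : nat) (a : nat -> R[i]).
Hypotheses (N0 : (0 < N)%N) (az : mean_zero N a).
Implicit Types (z w s : R[i]) (x t : R).

(** The sequence (k + 1)^(-s). *)
Definition dpow s k : R[i] := cexp (- s * (ln k.+1%:R)%:C).

Lemma iter_nabla_dpow r s k :
  iter r (@nabla R[i]) (dpow s) k = iter r (@step_diff R) (powlog s 0) k.+1%:R.
Proof.
elim: r k => [|r IH] k /=; first by rewrite powlog0.
by rewrite /nabla /step_diff !IH natr1.
Qed.

(** Comparison of 1 / (k + 1)^2 with a telescoping series. *)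
Lemma sum_inv_sqr_le n : \sum_(k < n) expR (- 2 * ln k.+1%:R) <= 2 :> R.
Proof.
suff H : \sum_(k < n) expR (- 2 * ln k.+1%:R) <= 2 - 2 / n.+1%:R :> R.
  by apply: le_trans H _; rewrite gerBl divr_ge0.
elim: n => [|n IH]; first by rewrite big_ord0 divr1 subrr.
rewrite big_ord_recr /=; apply: le_trans (lerD IH (lexx _)) _.
have n0 : 0 < n.+1%:R :> R by [].
rewrite (_ : - 2 * _ = - (ln n.+1%:R + ln n.+1%:R)); last by ring.
rewrite expRN expRD lnK ?posrE //.
rewrite -[n.+2%:R]natr1; move: (n.+1%:R : R) n0 (ler1n R n.+1) => x x0 hx; have x1 : 1 <= x by rewrite hx.
rewrite -subr_ge0 [X in 0 <= X](_ : _ = (x - 1) / (x * x * (x + 1))); last first.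
  have x_neq0 : x != 0 by rewrite gt_eqF.
  have x1_neq0 : x + 1 != 0 by rewrite gt_eqF //; lra.
  by field; rewrite x_neq0 x1_neq0.
by rewrite divr_ge0 ?mulr_ge0 //; lra.
Qed.

Lemma periodic_bounded (b : nat -> R[i]) : seq_periodic N b ->
  exists2 B : R, 0 <= B & forall k, cabs (b k) <= B.
Proof.
move=> bp; exists (\sum_(k < N) cabs (b k)).
  by apply: sumr_ge0 => k _; exact: cabs_ge0.
move=> k; rewrite -(periodic_modn k bp) (bigD1 (Ordinal (ltn_pmod k N0))) //= lerDl.
by apply: sumr_ge0 => i _; exact: cabs_ge0.
Qed.

Local Notation a_ r := (iter r (antidiffS N) a).

Lemma antidiff_bounded r : exists2 B : R, 0 <= B & forall k, cabs (antidiff N (a_ r) k) <= B.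
Proof.
by apply: periodic_bounded; case: (antidiff_mean_zero N0 (antidiffS_mean_zero r N0 az)).
Qed.

Lemma iter_antidiff_bounded r : exists2 B : R, 0 <= B & forall k, cabs (a_ r k) <= B.
Proof. by apply: periodic_bounded; case: (antidiffS_mean_zero r N0 az). Qed.

Lemma iter_nabla_dpow_bound r s k : 0 <= complex.Re s + r%:R ->
  cabs (iter r (@nabla R[i]) (dpow s) k) <=
  decay_const 0 r s * expR ((0 - complex.Re s - r%:R) * ln k.+1%:R).
Proof.
move=> h; rewrite iter_nabla_dpow.
have := @iter_powlog_decay R 0 r s 0 k.+1%:R (lexx _) (ler1n _ _).
by rewrite expr0 mulr1; apply; lra.
Qed.

Lemma iter_nabla_dpow_small r s e : 1 <= complex.Re s + r%:R -> 0 < e ->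
  exists n0, forall k, (n0 <= k)%N -> cabs (iter r (@nabla R[i]) (dpow s) k) < e.
Proof.
move=> h e0; set C := decay_const 0 r s.
have [n0 hn0] : exists n0 : nat, C / e < n0%:R.
  by exists (Num.bound (`|C / e|)); apply: le_lt_trans (ler_norm _) (archi_boundP _).
exists n0 => k n0k.
have k0 : 0 < k.+1%:R :> R by [].
have := @iter_nabla_dpow_bound r s k; rewrite -/C => /(_ _)/le_lt_trans; apply; first lra.
apply: (@le_lt_trans _ _ (C * expR (-1 * ln k.+1%:R))).
  rewrite ler_wpM2l ?decay_const_ge0 // ler_expR.
  by rewrite ler_wpM2r ?ln_ge0 ?ler1n //; lra.
rewrite mulN1r expRN lnK ?posrE // ltr_pdivrMr // mulrC -ltr_pdivrMr //.
by apply: lt_le_trans hn0 _; rewrite ler_nat (leq_trans n0k).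
Qed.

(** l is the value at s of the continuation to Re s > 1 - r obtained by r
    summations by parts. *)
Definition partial_cont r s (l : R[i]) : Prop :=
  exists2 T : R[i], has_sum (fun k => a_ r k * iter r (@nabla R[i]) (dpow s) k) T &
    l = boundary_sum N r a (dpow s) + T.

(** Abel summation; the boundary term at infinity vanishes because
    antidifferences of periodic sequences of mean zero are bounded. *)
Lemma has_sum_by_parts (b f : nat -> R[i]) T : 
  (exists2 B : R, 0 <= B & forall k, cabs (antidiff N b k) <= B) ->
  (forall e : R, 0 < e -> exists n0, forall k, (n0 <= k)%N -> cabs (f k) < e) ->
  has_sum (fun k => antidiffS N b k * nabla f k) T ->
  has_sum (fun k => b k * f k) (- (antidiff N b 0 * f 0) + T).
Proof.
move=> [B B0 bB] f0 /has_csumP hT; apply/has_csumP => e e0.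
have e2 : 0 < e / 2 by lra.
have [n0 hn0] := hT _ e2.
have [|n1 hn1] := f0 (e / 2 / (B + 1)); first by rewrite divr_gt0 //; lra.
exists (maxn n0 n1) => n; rewrite geq_max => /andP[/hn0 h0 /hn1 h1].
have E : \sum_(k < n) b k * f k = antidiff N b n * f n - antidiff N b 0 * f 0 +
    \sum_(k < n) antidiffS N b k * nabla f k.
  elim: n {h0 h1} => [|n IH]; first by rewrite !big_ord0 subrr addr0.
  rewrite !big_ord_recr /= IH /antidiffS /nabla -(antidiff_diff N b n).
  by move: (antidiff _ _ _) (antidiff _ _ _) (antidiff _ _ _) => x y u; ring.
have -> : - (antidiff N b 0 * f 0) + T - \sum_(k < n) b k * f k =
   (T - \sum_(k < n) antidiffS N b k * nabla f k) + - (antidiff N b n * f n).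
  by rewrite E; ring.
apply: le_lt_trans (cabsD _ _) _; rewrite cabsN cabsM.
move: h1; rewrite ltr_pdivlMr; last by lra.
have := bB n; have := cabs_ge0 (f n); have := cabs_ge0 (antidiff N b n).
nra.
Qed.

Lemma partial_contS r s l : 1 <= complex.Re s + r%:R ->
  partial_cont r.+1 s l -> partial_cont r s l.
Proof.
move=> h [T hT ->].
exists (- (antidiff N (a_ r) 0 * iter r (@nabla R[i]) (dpow s) 0) + T).
  apply: has_sum_by_parts hT; first exact: antidiff_bounded.
  by move=> e; exact: iter_nabla_dpow_small.
by rewrite /boundary_sum big_ord_recr /= opprD addrA.
Qed.

(** The continuations to larger and larger half-planes are compatible. *)
Lemma partial_cont_le r r' s l : (r <= r')%N -> 1 <= complex.Re s + r%:R ->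
  partial_cont r' s l -> partial_cont r s l.
Proof.
elim: r' => [|r' IH]; first by rewrite leqn0 => /eqP ->.
rewrite leq_eqVlt => /orP[/eqP -> //|]; rewrite ltnS => rr h h'.
apply: IH => //; apply: partial_contS h'; apply: le_trans h _.
by rewrite lerD2l ler_nat.
Qed.

Lemma partial_cont_uniq r s l l' : partial_cont r s l -> partial_cont r s l' -> l = l'.
Proof. by move=> [T hT ->] [T' hT' ->]; rewrite (has_sum_uniq hT hT'). Qed.

Lemma partial_cont_exists r s : 2 <= complex.Re s + r%:R -> exists l, partial_cont r s l.
Proof.
move=> h; have [B B0 hB] := iter_antidiff_bounded r.
set C := decay_const 0 r s.
have C0 : 0 <= C by exact: decay_const_ge0.
have [n|T hT] := @has_sum_exists R (fun k => a_ r k * iter r (@nabla R[i]) (dpow s) k) (B * C * 2).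
  apply: (@le_trans _ _ (\sum_(k < n) B * C * expR (- 2 * ln k.+1%:R))).
    apply: ler_sum => k _; rewrite cabsM -mulrA ler_pM ?cabs_ge0 //.
    have := @iter_nabla_dpow_bound r s k; rewrite -/C => /(_ _)/le_trans; apply; first lra.
    rewrite ler_wpM2l // ler_expR ler_wpM2r ?ln_ge0 ?ler1n //; lra.
  by rewrite -mulr_sumr ler_wpM2l ?mulr_ge0 // sum_inv_sqr_le.
by exists (boundary_sum N r a (dpow s) + T), T.
Qed.

(** A number of summations by parts sufficient for absolute convergence at s. *)
Definition cont_order s : nat := Num.bound `|2 - complex.Re s|.

Lemma cont_orderP s : 2 <= complex.Re s + (cont_order s)%:R.
Proof.
have := archi_boundP (normr_ge0 (2 - complex.Re s)); rewrite -/(cont_order s).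
have := ler_norm (2 - complex.Re s); lra.
Qed.

Definition continuation s : R[i] := xget 0 [set l | partial_cont (cont_order s) s l].

Lemma continuationP r s : 2 <= complex.Re s + r%:R -> partial_cont r s (continuation s).
Proof.
move=> h; have [l hl] := partial_cont_exists h.
have hc : partial_cont (cont_order s) s (continuation s).
  have [l' hl'] := partial_cont_exists (cont_orderP s).
  exact: (xgetPex 0 (ex_intro _ l' hl')).
have hs := cont_orderP s.
case: (leqP r (cont_order s)) => rs; first by apply: partial_cont_le hc => //; lra.
have hl' : partial_cont (cont_order s) s l by apply: partial_cont_le hl; [exact: ltnW|lra].
by rewrite (partial_cont_uniq hc hl').
Qed.

Lemma continuation_series s : 1 < complex.Re s ->
  has_sum (fun k => a k * dpow s k) (continuation s).
Proof.
move=> s1; have h : 1 <= complex.Re s + 0%:R by rewrite addr0 ltW.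
have [T hT ->] := partial_cont_le (leq0n _) h (continuationP (cont_orderP s)).
by rewrite /boundary_sum big_ord0 oppr0 add0r.
Qed.

Lemma has_sum_nabla_dpow r s h k :
  has_sum (fun j => iter r (@step_diff R) (powlog s j) k.+1%:R * h ^+ j)
   (iter r (@nabla R[i]) (dpow (s + h)) k).
Proof. by rewrite iter_nabla_dpow; exact: has_sum_iter_powlog. Qed.

(** Around s a single r serves for all z with |z - s| < 1/2. The bound of
    [iter_powlog_decay] with rho = 1 on the Taylor coefficients of the terms is what
    [has_sum_power_series] requires. *)
Lemma continuation_analytic s : analytic_at continuation s.
Proof.
apply/analytic_atP.
(* The exponent 1 - Re s - r in the decay of the Taylor coefficients must be at most -2
   and 2 <= Re z + r must hold for all z at distance 1/2 from s. *)
pose r := Num.bound (4 + `|complex.Re s|).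
have rE : 4 <= complex.Re s + r%:R.
  have : 4 + `|complex.Re s| < r%:R by apply: archi_boundP; rewrite addr_ge0.
  have := ler_norm (- complex.Re s); rewrite normrN; lra.
have [B B0 hB] := iter_antidiff_bounded r.
set C := decay_const 1 r s.
have C0 : 0 <= C by apply: decay_const_ge0; exact: ler01.
pose c k j := a_ r k * iter r (@step_diff R) (powlog s j) k.+1%:R.
pose M k : R := B * C * expR (- 2 * ln k.+1%:R).
have cM k j : cabs (c k j) * 1 ^+ j <= M k.
  have := @iter_powlog_decay R 1 r s j k.+1%:R ler01 (ler1n _ _).
  rewrite expr1n !mulr1 -/C => /(_ _) h; rewrite /c /M cabsM -mulrA ler_pM ?cabs_ge0 //.
  apply: le_trans (h _) _; first lra.
  by rewrite ler_wpM2l // ler_expR ler_wpM2r ?ln_ge0 ?ler1n //; lra.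
have MC n : \sum_(k < n) M k <= B * C * 2.
  rewrite /M -mulr_sumr; apply: ler_wpM2l; first exact: mulr_ge0.
  exact: sum_inv_sqr_le.
have [A hA] : {A : nat -> R[i] & forall j, has_sum (c^~ j) (A j)}.
  apply: (@boolp.choice _ _ (fun j l => has_sum (c^~ j) l)) => j.
  apply: (@has_sum_exists _ _ (B * C * 2)) => n; apply: le_trans (MC n).
  by apply: ler_sum => k _; have := cM k j; rewrite expr1n mulr1.
pose A0 j : R[i] := - \sum_(i < r) antidiff N (a_ i) 0 * iter i (@step_diff R) (powlog s j) 1.
exists (fun j => A0 j + A j), (1 / 2); first by lra.
move=> z hz; set h := z - s in hz *.
have zE : z = s + h by rewrite /h addrC subrK.
have Rh : `|complex.Re h| <= 1 / 2 by apply: le_trans (cabs_Re _) (ltW hz).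
have rz : 2 <= complex.Re z + r%:R.
  rewrite zE complex_ReD; have := ler_norm (- complex.Re h); rewrite normrN; lra.
have [T hT ->] := continuationP rz.
have h1 : has_sum (fun j => A0 j * h ^+ j) (boundary_sum N r a (dpow z)).
  have h2 (i : 'I_r) := has_sumZ (a := antidiff N (a_ i) 0) (@has_sum_nabla_dpow i s h 0).
  have := has_sumZ (a := -1) (has_sum_sum (r := index_enum 'I_r) h2).
  rewrite mulN1r -zE /boundary_sum; apply: has_sum_ext => j.
  rewrite /A0 mulN1r mulNr mulr_suml; congr (- _); apply: eq_bigr => i _.
  by rewrite mulrA.
have h3 : has_sum (fun j => A j * h ^+ j) T.
  apply: (@has_sum_power_series R c A _ T h M (B * C * 2) 1 ltr01 MC cM (ltW hz) hA _ hT) => k.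
  have := has_sumZ (a := a_ r k) (@has_sum_nabla_dpow r s h k); rewrite -zE.
  by apply: has_sum_ext => j; rewrite /c mulrA.
by apply: has_sum_ext (has_sumD h1 h3) => j; rewrite mulrDl.
Qed.

(** At s = 1 - m the sequence (k + 1)^(-s) is polynomial in k, and its
    differences of high order vanish: the continuation is a finite boundary
    term. *)
Lemma continuation_value (p : {poly R[i]}) s r : (size p <= r)%N ->
  (forall k, dpow s k = p.[k%:R]) ->
  continuation s = boundary_sum N r a (fun k => p.[k%:R]).
Proof.
move=> pr /funext hp.
pose r' := maxn r (cont_order s).
have h : 2 <= complex.Re s + r'%:R.
  by apply: le_trans (cont_orderP s) _; rewrite lerD2l ler_nat leq_maxr.
have [T hT ->] := continuationP h; rewrite hp in hT *.
have vanish i k : (r <= i)%N -> iter i (@nabla R[i]) (fun k => p.[k%:R]) k = 0.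
  by move=> ri; apply: iter_nabla_poly; exact: leq_trans ri.
have -> : T = 0.
  apply: has_sum_uniq hT _; apply: has_sum_ext (@has_sum0 R) => k.
  by rewrite vanish ?mulr0 // leq_maxl.
rewrite addr0 /boundary_sum; congr (- _).
rewrite -[r'](subnKC (leq_maxl r (cont_order s))) big_split_ord /= [X in _ + X]big1 ?addr0 //.
by move=> i _; rewrite vanish ?mulr0 // leq_addr.
Qed.
End Continuation.

(** * The value of the L-function *)
Local Close Scope classical_set_scope.

Section Uniqueness.
Variable R : realType.

Lemma analytic_atB (f g : R[i] -> R[i]) z0 :
  analytic_at f z0 -> analytic_at g z0 -> analytic_at (fun z => f z - g z) z0.
Proof.
move=> /analytic_atP[a [d d0 ha]] /analytic_atP[b [e e0 hb]].
apply/analytic_atP; exists (fun k => a k - b k), (Num.min d e); first by rewrite lt_min d0.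
move=> z; rewrite lt_min => /andP[/ha h1 /hb h2].
have := has_sumD h1 (has_sumZ (a := -1) h2).
by rewrite mulN1r; apply: has_sum_ext => k; ring.
Qed.

(** Two continuations agree near 2 + i, and the real line through 2 + i and
    1 - m avoids 1, so [identity_line] applies. *)
Lemma dirichlet_L_uniq (rho : int -> R[i]) (L1 L2 : R[i] -> R[i]) m : (0 < m)%N ->
  is_dirichlet_L rho L1 -> is_dirichlet_L rho L2 -> L1 (1 - m%:R) = L2 (1 - m%:R).
Proof.
move=> m0 [s1 a1] [s2 a2]; apply/eqP; rewrite -subr_eq0; apply/eqP.
pose p : R[i] := 2 +i* 1; pose q : R[i] := (1 - m%:R) - p.
have mE : m%:R = (m%:R : R)%:C by rewrite rmorph_nat.
have ReE (t : R) : complex.Re (p + t%:C * q) = 2 + t * (- 1 - m%:R).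
  by rewrite /q mE /p /=; simpc => /=; ring.
have ImE (t : R) : complex.Im (p + t%:C * q) = 1 - t.
  by rewrite /q mE /p /=; simpc => /=; ring.
have q0 : q != 0.
  by apply/eqP => /(congr1 (@complex.Im R)); rewrite /q mE /p /=; simpc => /= /eqP; rewrite oppr_eq0 oner_eq0.
have m1 : 1 <= m%:R :> R by rewrite ler1n.
have := @identity_line R (fun z => L1 z - L2 z) p q 1 q0 _ ltr01 _ 1.
have -> : p + 1%:C * q = 1 - m%:R by rewrite mul1r addrC subrK.
apply.
  move=> t; have t1 : p + t%:C * q != 1.
    apply/eqP => e; move: (ImE t) (ReE t); rewrite e /= => h1 h2.
    have tE : t = 1 by clear -h1; lra.
    by move: h2; rewrite tE; clear -m1; lra.
  by apply: analytic_atB; [exact: a1|exact: a2].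
move=> z hz; have hr : 1 < complex.Re z.
  have := le_lt_trans (cabs_Re _) hz; rewrite complex_ReD /p /= ltr_norml => /andP[? _].
  lra.
by rewrite (has_sum_uniq (s1 z hr) (s2 z hr)) subrr.
Qed.

Lemma dirichlet_LP (N : nat) (rho : int -> R[i]) m : (0 < N)%N -> (0 < m)%N ->
  mean_zero N (fun k => rho k.+1%:Z) ->
  dirichlet_L rho (1 - m%:R) = continuation N (fun k => rho k.+1%:Z) (1 - m%:R).
Proof.
move=> N0 m0 az.
have hc : is_dirichlet_L rho (continuation N (fun k => rho k.+1%:Z)).
  by split=> s hs; [exact: continuation_series|exact: continuation_analytic].
have hL : is_dirichlet_L rho (dirichlet_L rho).
  by have /(xgetPex (fun=> 0)) : exists L, [set L | is_dirichlet_L rho L]%classic L by eexists; exact: hc.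
exact: dirichlet_L_uniq m0 hL hc.
Qed.

Lemma dpow_integer (m k : nat) : dpow (1 - m.+1%:R) k = k.+1%:R ^+ m :> R[i].
Proof.
rewrite /dpow -natr1 opprB addrK -[m%:R](rmorph_nat (real_complex R)) -rmorphM.
rewrite /cexp /= cos0 sin0 expRM_natl lnK ?posrE // rmorphXn /= rmorph_nat.
by simpc.
Qed.
End Uniqueness.

(** Both sides are the same boundary term, by [continuation_value] and
    [regsum_boundary]. *)
Theorem dirichlet_L_regsum (R : realType) (iota : {rmorphism algC -> R[i]}) N m
    (rho : int -> algC) l : (0 < N)%N -> mean_zero N (fun k => rho k%:Z) -> rho 0 = 0 ->
  regsum (fun k => k%:R ^+ m * rho k%:Z) l ->
  iota l = dirichlet_L (fun a => iota (rho a)) (1 - m.+1%:R).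
Proof.
move=> N0 az r0 hl.
pose a k := rho k.+1%:Z; pose p (F : numFieldType) : {poly F} := ('X + 1) ^+ m.
have sp F : (size (p F) <= m.+1)%N.
  have -> : p F = ('X - (- 1)%:P) ^+ m by rewrite /p polyCN opprK.
  by rewrite size_exp_XsubC.
have pE F k : (p F).[k%:R] = k.+1%:R ^+ m by rewrite /p horner_exp !hornerE natr1.
have aaz : mean_zero N a := mean_zeroS az.
have iaz : mean_zero N (fun k => iota (a k)).
  split; first by move=> k; rewrite aaz.1.
  by rewrite -rmorph_sum aaz.2 rmorph0.
rewrite (dirichlet_LP N0) // (continuation_value N0 iaz (sp _)); last first.
  by move=> k; rewrite dpow_integer pE.
have -> : l = boundary_sum N m.+1 a (fun k => (p _).[k%:R]).
  apply: (regsum_uniq _ (regsum_boundary N0 aaz (sp _))).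
  have := regsumS hl; rewrite r0 mulr0 subr0; apply: regsum_ext => k.
  by rewrite pE mulrC.
rewrite boundary_sum_rmorph; congr (boundary_sum _ _ _ _); apply/funext => k /=.
by rewrite !pE rmorphXn rmorph_nat.
Qed.

Theorem proposition1p5 (R : realType) (iota : {rmorphism algC -> R[i]})
    (ord2 : algC -> \bar R) (hord2 : dyadic_valuation ord2)
    (m d : nat) (hm0 : (0 < m)%N) (hm : ~~ odd m)
    (hd0 : (1 <= d)%N) (hdsf : squarefree d) (hdodd : odd d)
    (psi : int -> algC) (hpsi : quadratic_character d psi) :
  exists2 n_d : nat, (0 < n_d)%N &
    forall (n : nat) (chi : int -> algC), (n_d <= n)%N ->
      primitive_layer_character n chi ->
      exists2 l : algC,
        iota l = dirichlet_L (fun a : int => iota (chi a * psi a)) (1 - m%:R) &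
        ord2 l = (1 + 2 ^ (1 - n%:Z) *
                    (-1 + \sum_(p <- primes d) 2 ^+ fexp p))%:E.
Proof.
(* With S the sum of the 2^(f_p), both n - 1 > f_p and 2^(n-1) > S hold for n >= 2 + S. *)
exists (2 + \sum_(p <- primes d) 2 ^ fexp p)%N => // n chi hn hchi.
have n1 : (0 < n)%N by lia.
case: m hm0 hm => // m _; rewrite oddS negbK => om.
have az := twist_mean_zero n1 hd0 hdodd hpsi hchi.
have N0 := twist_period_gt0 n hd0.
have [l hl] := mean_zero_regsum_poly 'X^m N0 az.
have {}hl : regsum (fun k => k%:R ^+ m * (chi k%:Z * psi k%:Z)) l.
  by apply: regsum_ext hl => k; rewrite hornerXn mulrC.
exists l; last exact: val_regsum_twist hl.
apply: (@dirichlet_L_regsum _ iota _ _ (fun a => chi a * psi a) _ N0 az _ hl).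
by rewrite (layer_even hchi) ?mul0r.
Qed.
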